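(* Let $k>3$ be a fixed integer. The problems $\textsc{EnumClosureMax}_{S_{12}^k}$ and $\textsc{EnumKMaxIndSet}$ (for hypergraphs of dimension $k$) are equivalent under polynomial delay reductions.
   Context: Boolean vectors in $\{0,1\}^n$ are ordered by inclusion of their sets of $1$-coordinates. Operations act coordinate-wise on vectors; $Cl_{\mathcal{F}}(\mathcal{S})$ is the smallest set containing $\mathcal{S}$ closed under the operations of $\mathcal{F}$. $Th_k^{k+1}:\{0,1\}^{k+1}\to\{0,1\}$ returns $1$ iff at least $k$ of its arguments are $1$. $S_{12}^k$ is the clone generated by $Th_k^{k+1}$ and the ternary operation $x\wedge(y\to z)$. $\textsc{EnumClosureMax}_{\mathcal{F}}$: given finite $\mathcal{S}\subseteq\{0,1\}^n$, enumerate without repetition the maximal elements of $Cl_{\mathcal{F}}(\mathcal{S})\setminus\{\mathbf{0},\mathbf{1}\}$. A hypergraph has dimension $k$ if its largest hyperedge has size $k$; an independent set is a vertex subset containing no hyperedge; $\textsc{EnumKMaxIndSet}$: given a hypergraph of dimension $k$, enumerate its inclusion-maximal independent sets. A polynomial delay reduction from $A$ to $B$ consists of a polynomial-time function $f$ and an enumeration problem $C$ solvable with polynomial delay such that for every instance $x$ of $A$: for distinct $y,z\in B(f(x))$, $C(xy)\cap C(xz)=\emptyset$, and $A(x)=\bigcup_{y\in B(f(x))}C(xy)$. Equivalent means each reduces to the other. *)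

(* Defs.v *)
From HB Require Import structures.
From mathcomp Require Import all_boot all_order all_algebra.

Set Implicit Arguments.
Unset Strict Implicit.
Unset Printing Implicit Defensive.

(* The alphabet is {0, 1, #}: [Some b] is the bit b and [None] is #. *)
Definition letter := option bool.
Definition word := seq letter.
Definition bits (s : seq bool) : word := map Some s.

(** * Machine model

  A random access machine under the logarithmic cost criterion. It has finitely
  many word registers (those named in the program), read and modified at their
  first letter, and a memory of words addressed by words. Every elementary step
  costs one time unit, except those that move whole words, which also pay for
  the letters involved. Without [Fetch] and [Store] this is a multi-stack (hence
  a multi-tape Turing) machine. *)

Definition reg := nat.

Inductive cmd : Type :=
| Skip
| Push of reg & letter
| Pop of reg
| Fetch of reg & reg
| Store of reg & reg
| Output of reg
| Seq of cmd & cmd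
| If of reg & option letter & cmd & cmd
| While of reg & option letter & cmd.

Record state := State { regs : reg -> word; mem : word -> word }.

Definition upd (T : eqType) (U : Type) (f : T -> U) (x : T) (u : U) : T -> U :=
  fun z => if z == x then u else f z.

Definition set_reg (s : state) (x : reg) (w : word) : state :=
  State (upd (regs s) x w) (mem s).

Definition set_mem (s : state) (a w : word) : state :=
  State (regs s) (upd (mem s) a w).

Inductive event : Type := Tick | Out of word.

Definition ticks (n : nat) : seq event := nseq n Tick.

(* [exec c s t s']: started in s, the command c halts in s' with trace t. In
   [If x o] and [While x o] the register x is tested against o, where [None]
   stands for the empty word and [Some a] for the words starting with a;
   [While x o c] repeats c until the test succeeds. *)
Inductive exec : cmd -> state -> seq event -> state -> Prop :=
| exec_Skip s : exec Skip s (ticks 1) s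
| exec_Push s x a :
    exec (Push x a) s (ticks 1) (set_reg s x (a :: regs s x))
| exec_Pop s x :
    exec (Pop x) s (ticks 1) (set_reg s x (behead (regs s x)))
| exec_Fetch s x y :
    exec (Fetch x y) s
         (ticks (size (regs s y) + size (mem s (regs s y))).+1)
         (set_reg s x (mem s (regs s y)))
| exec_Store s x y :
    exec (Store x y) s
         (ticks (size (regs s x) + size (regs s y)).+1)
         (set_mem s (regs s x) (regs s y))
| exec_Output s x :
    exec (Output x) s (rcons (ticks (size (regs s x)).+1) (Out (regs s x))) s
| exec_Seq c1 c2 s1 s2 s3 t1 t2 :
    exec c1 s1 t1 s2 -> exec c2 s2 t2 s3 ->
    exec (Seq c1 c2) s1 (t1 ++ t2) s3
| exec_If_true x o c1 c2 s1 s2 t :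
    ohead (regs s1 x) = o -> exec c1 s1 t s2 ->
    exec (If x o c1 c2) s1 (Tick :: t) s2
| exec_If_false x o c1 c2 s1 s2 t :
    ohead (regs s1 x) <> o -> exec c2 s1 t s2 ->
    exec (If x o c1 c2) s1 (Tick :: t) s2
| exec_While_stop x o c s :
    ohead (regs s x) = o -> exec (While x o c) s [:: Tick] s
| exec_While_step x o c s1 s2 s3 t1 t2 :
    ohead (regs s1 x) <> o -> exec c s1 t1 s2 ->
    exec (While x o c) s2 t2 s3 ->
    exec (While x o c) s1 (Tick :: t1 ++ t2) s3.

Definition init (x : word) : state :=
  State (upd (fun=> [::]) 0 x) (fun=> [::]).

Definition outputs (t : seq event) : seq word :=
  pmap (fun e => if e is Out w then Some w else None) t.

Fixpoint gaps_from (d : nat) (t : seq event) : seq nat :=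
  match t with
  | [::] => [:: d]
  | Tick :: t' => gaps_from d.+1 t'
  | Out _ :: t' => d :: gaps_from 0 t'
  end.

(* The times elapsed before the first output, between consecutive outputs, and
   from the last output to the end of the run. *)
Definition gaps (t : seq event) : seq nat := gaps_from 0 t.

(** * Enumeration problems and polynomial delay reductions *)

Record enum_problem := EnumProblem {
  inst : word -> Prop;
  sols : word -> word -> Prop
}.

Definition polytime_on (D : word -> Prop) (f : word -> word) : Prop :=
  exists (c : cmd) (p : {poly nat}), forall x, D x ->
    exists (t : seq event) (s : state),
      [/\ exec c (init x) t s,
          outputs t = [:: f x]
        & size t <= (p.[size x])%R].

Definition poly_delay (A : enum_problem) : Prop :=
  exists (c : cmd) (p : {poly nat}), forall x, inst A x ->
    exists (t : seq event) (s : state),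
      [/\ exec c (init x) t s,
          uniq (outputs t),
          forall y, y \in outputs t <-> sols A x y
        & forall d, d \in gaps t -> d <= (p.[size x])%R].

Definition pd_reduces (A B : enum_problem) : Prop :=
  exists (f : word -> word) (C : enum_problem),
    [/\ polytime_on (inst A) f,
        poly_delay C
      & forall x, inst A x ->
        [/\ inst B (f x),
            forall y, sols B (f x) y -> inst C (x ++ y),
            forall y z, sols B (f x) y -> sols B (f x) z -> y <> z ->
              forall u, ~ (sols C (x ++ y) u /\ sols C (x ++ z) u)
          & forall u, sols A x u <->
              exists y, sols B (f x) y /\ sols C (x ++ y) u]].

Definition pd_equivalent (A B : enum_problem) : Prop :=
  pd_reduces A B /\ pd_reduces B A.

(* A list of vectors of {0,1}^n is written 1^n # v_1 # ... v_m #. The set it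
   presents is the set of its entries; order and repetitions are irrelevant. *)
Definition encode n (s : seq (n.-tuple bool)) : word :=
  bits (nseq n true) ++ None ::
    flatten [seq rcons (bits v) None | v : n.-tuple bool <- s].

(** * Clones and closures *)

Definition op m := {ffun m.-tuple bool -> bool}.
Definition opset := forall m, op m -> Prop.

Inductive clone (G : opset) : opset :=
| clone_gen m (f : op m) : G m f -> clone G f
| clone_proj m (i : 'I_m) : clone G [ffun x : m.-tuple bool => tnth x i]
| clone_comp m n (f : op m) (g : 'I_m -> op n) :
    clone G f -> (forall i, clone G (g i)) ->
    clone G [ffun x : n.-tuple bool => f [tuple g i x | i < m]].

Definition Th k : op k.+1 :=
  [ffun x : k.+1.-tuple bool => k <= count id x].

Definition and_imp : op 3 :=
  [ffun x : 3.-tuple bool => nth false x 0 && (nth false x 1 ==> nth false x 2)].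

Inductive S12_gen (k : nat) : opset :=
| S12_gen_Th : S12_gen k (Th k)
| S12_gen_and_imp : S12_gen k and_imp.

Definition S12 (k : nat) : opset := clone (S12_gen k).

Inductive Cl (F : opset) n (S : {set n.-tuple bool}) : n.-tuple bool -> Prop :=
| Cl_base v : v \in S -> Cl F S v
| Cl_op m (f : op m) (v : 'I_m -> n.-tuple bool) :
    F m f -> (forall j, Cl F S (v j)) ->
    Cl F S [tuple f [tuple tnth (v j) i | j < m] | i < n].

Definition vec_le n (v w : n.-tuple bool) : Prop :=
  forall i, tnth v i -> tnth w i.

Definition maximal_in n (P : n.-tuple bool -> Prop) (v : n.-tuple bool) : Prop :=
  P v /\ forall w, P w -> vec_le v w -> w = v.

Definition Cl_proper (F : opset) n (S : {set n.-tuple bool}) v : Prop :=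
  [/\ Cl F S v, v <> [tuple false | _ < n] & v <> [tuple true | _ < n]].

Definition EnumClosureMax (F : opset) : enum_problem := {|
  inst x := exists n (s : seq (n.-tuple bool)), x = encode s;
  sols x y := exists n (s : seq (n.-tuple bool)) (v : n.-tuple bool),
    [/\ x = encode s, maximal_in (Cl_proper F [set:: s]) v & y = bits v]
|}.

(** * Hypergraphs *)

Definition hypergraph n := {set {set 'I_n}}.

Definition dimension n (H : hypergraph n) : nat := \max_(e in H) #|e|.

Definition independent n (H : hypergraph n) (I : {set 'I_n}) : bool :=
  [forall e in H, ~~ (e \subset I)].

Definition charvec n (A : {set 'I_n}) : n.-tuple bool := [tuple i \in A | i < n].

Definition EnumKMaxIndSet (k : nat) : enum_problem := {|
  inst x := exists n (s : seq {set 'I_n}),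
    x = encode (map (@charvec n) s) /\ dimension [set:: s] = k;
  sols x y := exists n (s : seq {set 'I_n}) (I : {set 'I_n}),
    [/\ x = encode (map (@charvec n) s), maxset (independent [set:: s]) I
      & y = bits (charvec I)]
|}.

(* Main.v *)
Require Import Defs.
From mathcomp Require Import all_boot.
From mathcomp Require Import all_order all_algebra zify.

(** Since [Th k] is a near-unanimity operation of arity k+1 and x /\ (y -> z)
  separates unequal columns, a nonzero vector lies in the closure of S iff it
  contains the constant-1 columns, does not separate equal columns, and each of
  its sets of at most k ones lies inside some member of S ([covb]). A maximal
  [covb] set satisfies the first two conditions automatically, so the maximal
  elements of the closure are the maximal independent sets of the hypergraph of
  the uncovered sets of size at most k, unless that hypergraph has no edge; then
  they are the complements of the classes of equal nonconstant columns, of which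
  there are at most n.

  Closure to hypergraph: k zero columns are added, which forces the dimension to
  be k without changing the maximal sets. Hypergraph to closure: S consists of
  the independent sets of size at most k, over one additional isolated vertex,
  which keeps the maximal sets nonempty.

  On the machine, all sets of at most k elements are obtained from the empty set
  by k rounds of setting one bit in all possible ways. *)

Set Implicit Arguments.
Unset Strict Implicit.
Unset Printing Implicit Defensive.

Import GRing.Theory.

(** * Register contents and running time *)

(** One program, [reduce a k d], computes both reductions: it adds [a] columns and keeps, among the
    nonempty sets of at most [k] columns, those below no input row ([d] true, uncovered sets) or
    above no input row ([d] false, independent sets). The number [k] enters twice for one reason: on
    [k] inputs where an operation of the clone is true some argument is true throughout, while
    [Th k] glues [k+1] vectors that each miss one point of a larger set. The obstacle is the vector
    of ones. If every small set of original columns is covered, it is the single maximal independent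
    set, yet it is excluded from the answers, and up to [n] vectors below it take its place. A
    reduction only asks that different [y] have disjoint [C(xy)], so this one [y] may be expanded
    into the whole list. In every case [C(xy)] has polynomial size; it is computed completely before
    anything is printed, and the total running time bounds every delay. Time bounds can therefore be
    generous: constants are absorbed by raising a base [b], at least 100, to a larger power. *)

Definition holds (l : seq word) (s : state) : Prop :=
  forall i, i < size l -> regs s i = nth [::] l i.

(** The trace is all ticks, so a [run] outputs nothing. Neither the memory nor the unlisted
    registers are described, so specifications compose whatever the memory holds. *)
Definition run (c : cmd) (l : seq word) (n : nat) (l' : seq word) : Prop :=
  forall s, holds l s ->
  exists m s', [/\ exec c s (ticks m) s', m <= n & holds l' s'].

Lemma holds_set l s x w : holds l s -> x < size l ->
  holds (set_nth [::] l x w) (set_reg s x w).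
Proof.
move=> hl xl i; rewrite size_set_nth (maxn_idPr xl) => il.
by rewrite nth_set_nth /= /upd; case: eqP => // _; apply: hl.
Qed.

Lemma run_le c l n l' m : run c l n l' -> n <= m -> run c l m l'.
Proof.
move=> r nm s /r[p [s' [e pn h]]]; exists p, s'; split=> //.
exact: leq_trans pn nm.
Qed.

Lemma run_Skip l : run Skip l 1 l.
Proof. by move=> s h; exists 1, s; split=> //; constructor. Qed.

Lemma run_Push x a l l' : x < size l ->
  set_nth [::] l x (a :: nth [::] l x) = l' -> run (Push x a) l 1 l'.
Proof.
move=> xl <- s h; exists 1, (set_reg s x (a :: regs s x)).
split=> //; first by constructor.
by rewrite (h _ xl); apply: holds_set.
Qed.

Lemma run_Pop x l l' : x < size l ->
  set_nth [::] l x (behead (nth [::] l x)) = l' -> run (Pop x) l 1 l'.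
Proof.
move=> xl <- s h; exists 1, (set_reg s x (behead (regs s x))).
split=> //; first by constructor.
by rewrite (h _ xl); apply: holds_set.
Qed.

Lemma run_Seq c1 c2 l l1 l2 n1 n2 :
  run c1 l n1 l1 -> run c2 l1 n2 l2 -> run (Seq c1 c2) l (n1 + n2) l2.
Proof.
move=> r1 r2 s /r1[m1 [s1 [e1 le1]]] /r2[m2 [s2 [e2 le2 h2]]].
exists (m1 + m2), s2; split; [|by apply: leq_add|by []].
by rewrite /ticks nseqD; apply: exec_Seq e1 e2.
Qed.

Lemma run_If_true x o c1 c2 l n l' : x < size l ->
  ohead (nth [::] l x) = o -> run c1 l n l' -> run (If x o c1 c2) l n.+1 l'.
Proof.
move=> xl ho r s h; have [m [s' [e le h']]] := r s h.
exists m.+1, s'; split=> //; apply: exec_If_true e.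
by rewrite (h _ xl).
Qed.

Lemma run_If_false x o c1 c2 l n l' : x < size l ->
  ohead (nth [::] l x) <> o -> run c2 l n l' -> run (If x o c1 c2) l n.+1 l'.
Proof.
move=> xl ho r s h; have [m [s' [e le h']]] := r s h.
exists m.+1, s'; split=> //; apply: exec_If_false e.
by rewrite (h _ xl).
Qed.

Lemma run_While_stop x o c l : x < size l ->
  ohead (nth [::] l x) = o -> run (While x o c) l 1 l.
Proof.
move=> xl ho s h; exists 1, s; split=> //.
by apply: exec_While_stop; rewrite (h _ xl).
Qed.

Lemma run_While_step x o c l l1 l2 n1 n2 : x < size l ->
  ohead (nth [::] l x) <> o -> run c l n1 l1 -> run (While x o c) l1 n2 l2 ->
  run (While x o c) l (n1 + n2).+1 l2.
Proof.
move=> xl ho r1 r2 s h; have [m1 [s1 [e1 le1 h1]]] := r1 s h.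
have [m2 [s2 [e2 le2 h2]]] := r2 s1 h1.
exists (m1 + m2).+1, s2; split; [|by rewrite ltnS leq_add|by []].
rewrite /ticks /= nseqD; apply: exec_While_step e1 e2.
by rewrite (h _ xl).
Qed.

(* The memory cell addressed by the copied word itself serves as scratch space. *)
Definition copy (x y : reg) : cmd := Seq (Store x x) (Fetch y x).

Lemma run_copy x y l l' : x < size l -> y < size l ->
  set_nth [::] l y (nth [::] l x) = l' ->
  run (copy x y) l (4 * size (nth [::] l x) + 2) l'.
Proof.
move=> xl yl <- s h; rewrite -(h _ xl); set w := regs s x.
(* The word [w] is both address and content, so [Store] and [Fetch] each cost twice its length plus
   one; the fetched cell has just been written. *)
exists ((size w + size w).+1 + (size w + size w).+1), (set_reg (set_mem s w w) y w).
split; [|lia|].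
  rewrite /ticks nseqD; apply: exec_Seq; first exact: exec_Store.
  have e := exec_Fetch (set_mem s w w) y x.
  by rewrite /= /upd -/w eqxx in e.
by apply: holds_set => //; move=> i il; apply: h.
Qed.

(** * Transfer of letters and rows between registers *)

Definition put_letter x y :=
  If x (Some (Some true)) (Push y (Some true))
    (If x (Some (Some false)) (Push y (Some false)) (Push y None)).

Definition move_letter x y := Seq (put_letter x y) (Pop x).

Lemma run_put_letter x y l l' a w : x < size l -> y < size l ->
  nth [::] l x = a :: w -> set_nth [::] l y (a :: nth [::] l y) = l' ->
  run (put_letter x y) l 3 l'.
Proof.
move=> xl yl E <-; rewrite /put_letter; case: a E => [[]|] E.
- by apply: (@run_le _ _ 2) => //; apply: run_If_true; rewrite ?E //; apply: run_Push.
- apply: run_If_false; rewrite ?E //; apply: run_If_true; rewrite ?E //.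
  exact: run_Push.
- apply: run_If_false; rewrite ?E //; apply: run_If_false; rewrite ?E //.
  exact: run_Push.
Qed.

Lemma run_move_letter x y l l' a w : x < size l -> y < size l -> x != y ->
  nth [::] l x = a :: w ->
  set_nth [::] (set_nth [::] l y (a :: nth [::] l y)) x w = l' ->
  run (move_letter x y) l 4 l'.
Proof.
move=> xl yl xy E <-; rewrite -[4]/(3 + 1).
apply: run_Seq; first exact: (run_put_letter xl yl E).
apply: run_Pop; first by rewrite size_set_nth leq_max xl orbT.
by rewrite nth_set_nth /= (negPf xy) E.
Qed.

(* The two uses: [o = None] empties [x], and [o = Some None] stops at a separator. *)
Definition move_until x o y := While x o (move_letter x y).

Lemma set_nth2 (l : seq word) x y u w : set_nth [::] (set_nth [::] l x w) y u =
  if x == y then set_nth [::] l y u else set_nth [::] (set_nth [::] l y u) x w.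
Proof. exact: set_set_nth. Qed.

(** Registers are stacks, so the moved prefix arrives reversed. Each letter costs one test and the
    four steps of [move_letter]; the condition on [v] makes the loop stop exactly at [w]. *)
Lemma run_move_until x (o : option letter) y l l' (v w : word) :
  x < size l -> y < size l -> x != y ->
  nth [::] l x = v ++ w -> all (fun a => Some a != o) v -> ohead w = o ->
  set_nth [::] (set_nth [::] l y (rev v ++ nth [::] l y)) x w = l' ->
  run (move_until x o y) l (5 * size v + 1) l'.
Proof.
move=> + + xy; elim: v l l' => [|a v IH] l l' xl yl /= E.
  move=> _ ho <-.
  suff -> : set_nth [::] (set_nth [::] l y (nth [::] l y)) x w = l.
    by apply: run_While_stop; rewrite ?E.
  have idl z u : z < size l -> nth [::] l z = u -> set_nth [::] l z u = l.
    move=> zl <-; apply: (@eq_from_nth _ [::]).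
      by rewrite size_set_nth; apply/maxn_idPr.
    by move=> i _; rewrite nth_set_nth /=; case: eqP => [->|].
  by rewrite (idl y) // idl.
case/andP=> ha hv ho <-.
have sz : forall z u, z < size l -> size (set_nth [::] l z u) = size l.
  by move=> z u zl; rewrite size_set_nth; apply/maxn_idPr.
apply: (@run_le _ _ (4 + (5 * size v + 1)).+1); last by lia.
apply: run_While_step => //.
- by rewrite E /=; apply/eqP.
- exact: (run_move_letter xl yl xy E erefl).
apply: IH => //.
- by rewrite size_set_nth sz // leq_max xl orbT.
- by rewrite size_set_nth sz // leq_max yl orbT.
- by rewrite nth_set_nth /= eqxx.
rewrite !nth_set_nth /= eq_sym (negPf xy) nth_set_nth /= eqxx.
rewrite rev_cons cat_rcons.
rewrite (set_nth2 _ x y) (negPf xy) (set_nth2 _ y y) eqxx.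
by rewrite (set_nth2 _ x x) eqxx.
Qed.

Definition clear x := While x None (Pop x).

Lemma run_clear x l l' : x < size l -> set_nth [::] l x [::] = l' ->
  run (clear x) l (2 * size (nth [::] l x) + 1) l'.
Proof.
move: {2}(nth _ _ _) (erefl (nth [::] l x)) => w; elim: w l l' => [|a w IH] l l' E xl <-.
  suff -> : set_nth [::] l x [::] = l.
    by apply: (run_le (run_While_stop _ _ _)); rewrite ?E.
  apply: (@eq_from_nth _ [::]); first by rewrite size_set_nth; apply/maxn_idPr.
  by move=> i _; rewrite nth_set_nth /=; case: eqP => [->|].
rewrite E /=; apply: (@run_le _ _ (1 + (2 * size w + 1)).+1); last lia.
apply: run_While_step => //; [by rewrite E|exact: run_Pop|].
have -> : size w = size (nth [::] (set_nth [::] l x (behead (nth [::] l x))) x).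
  by rewrite nth_set_nth /= eqxx E.
apply: IH.
- by rewrite nth_set_nth /= eqxx E.
- by rewrite size_set_nth leq_max xl orbT.
- by rewrite set_nth2 eqxx.
Qed.

(** False is the empty word: the emptiness test of [If] reads a flag, [clear] resets it, and
    [raise], which never pushes twice, adds a disjunct. *)
Definition flag (b : bool) : word := nseq b (Some true).

Definition raise x := If x None (Push x (Some true)) Skip.

Lemma run_raise x l l' b : x < size l -> nth [::] l x = flag b ->
  set_nth [::] l x (flag true) = l' -> run (raise x) l 2 l'.
Proof.
move=> xl E <-; case: b E => E.
  apply: run_If_false; rewrite ?E //.
  suff -> : set_nth [::] l x (flag true) = l by apply: run_Skip.
  apply: (@eq_from_nth _ [::]); first by rewrite size_set_nth; apply/maxn_idPr.
  by move=> i _; rewrite nth_set_nth /=; case: eqP => [->|].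
by apply: run_If_true; rewrite ?E //; apply: run_Push; rewrite ?E.
Qed.

Lemma run_move_all x y l l' : x < size l -> y < size l -> x != y ->
  set_nth [::] (set_nth [::] l y (rev (nth [::] l x) ++ nth [::] l y)) x [::] = l' ->
  run (move_until x None y) l (5 * size (nth [::] l x) + 1) l'.
Proof.
move=> xl yl xy El'; apply: run_move_until El' => //; first by rewrite cats0.
exact/allP.
Qed.

Lemma run_move_row x y l l' (v : seq bool) (w : word) : x < size l -> y < size l -> x != y ->
  nth [::] l x = bits v ++ None :: w ->
  set_nth [::] (set_nth [::] l y (rev (bits v) ++ nth [::] l y)) x (None :: w) = l' ->
  run (move_until x (Some None) y) l (5 * size v + 1) l'.
Proof.
move=> xl yl xy E El'.
have -> : size v = size (bits v) by rewrite size_map.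
apply: run_move_until El' => //.
by rewrite all_map; apply/allP.
Qed.

(** Traversing a program leaves its cost and final registers to unification; the two remaining goals
    compare them with the announced ones. *)
Lemma run_conv c l n l' m l'' : run c l n l' -> n <= m -> l' = l'' -> run c l m l''.
Proof. by move=> r nm <-; apply: run_le nm. Qed.

Declare Scope cmd_scope.
Delimit Scope cmd_scope with cmd.
Notation "c1 ;; c2" := (Seq c1 c2) (at level 90, right associativity) : cmd_scope.

Ltac side := cbn [set_nth nth behead]; reflexivity.
Ltac run1 := first
  [ apply: run_Skip
  | eapply run_Push; [by []|side] | eapply run_Pop; [by []|side]
  | eapply run_copy; [by []|by []|side] | eapply run_clear; [by []|side]
  | eapply run_move_all; [by []|by []|by []|side]
  | eapply run_move_row; [by []|by []|by []|side|side]
  | eapply run_move_letter; [by []|by []|by []|side|side] ].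
Ltac runs := repeat (first [eapply run_Seq; [run1|] | run1]).

(** * Programs *)

Section Programs.
Local Open Scope cmd_scope.

Definition flat (L : seq (seq bool)) : word :=
  flatten [seq rcons (bits r) None | r <- L].

Lemma flat_cons r L : flat (r :: L) = bits r ++ None :: flat L.
Proof. by rewrite /flat /= cat_rcons. Qed.

Lemma flat_cat L1 L2 : flat (L1 ++ L2) = flat L1 ++ flat L2.
Proof. by rewrite /flat map_cat flatten_cat. Qed.

(* Register conventions: 0 holds the input rows, 1 the current list of vectors,
   5 the output in reverse order, 7 and 8 flags, 9 the header of the output. *)

Fixpoint exts (p e : seq bool) : seq (seq bool) :=
  if e is b :: e' then (rev p ++ true :: e') :: exts (b :: p) e' else [::].

(** The current row is held as a zipper: its passed prefix, reversed, in 2 and its remainder at the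
    front of 1; registers 3 and 4 are scratch. One step writes the row with the bit under the cursor
    set, then moves the cursor. *)
Definition ext_step : cmd :=
  copy 2 3;; move_until 3 None 4;; move_until 4 None 5;; Push 5 (Some true);;
  copy 1 3;; Pop 3;; move_until 3 (Some None) 5;; Push 5 None;; clear 3;;
  move_letter 1 2.

Lemma run_ext_step (R O W f g h w : word) b e p :
  run ext_step
    [:: R; Some b :: bits e ++ None :: w; bits p; [::]; [::]; O; W; f; g; h]
    (20 * (size p + size e + size w) + 40)
    [:: R; bits e ++ None :: w; bits (b :: p); [::]; [::];
      rev (rcons (bits (rev p ++ true :: e)) None) ++ O; W; f; g; h].
Proof.
rewrite /ext_step; apply: run_conv; first by runs.
- cbn [nth]; rewrite /= ?size_rev ?size_cat ?cats0 ?size_rev /= ?size_map; lia.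
- rewrite cats0 revK rev_rcons /bits map_cat rev_cat /= rev_cons map_rev revK.
  by rewrite cat_rcons -catA.
Qed.

Definition ext_row : cmd := While 1 (Some None) ext_step.

(** Every step copies register 1 with all the rows that follow, hence a cost linear in [M] for each
    letter. *)
Lemma run_ext_row (R O W f g h w : word) e p M : size p + size e + size w <= M ->
  run ext_row
    [:: R; bits e ++ None :: w; bits p; [::]; [::]; O; W; f; g; h]
    (size e * (20 * M + 50) + 1)
    [:: R; None :: w; bits (rev e ++ p); [::]; [::];
      rev (flat (exts p e)) ++ O; W; f; g; h].
Proof.
elim: e p O => [|b e IH] p O /= hM; first by apply: run_While_stop.
apply: run_conv.
- apply: run_While_step => //; first exact: run_ext_step.
  apply: IH; rewrite /=; lia.
- nia.
- by rewrite rev_cons cat_rcons flat_cons -(cat_rcons None) rev_cat -catA.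
Qed.

Definition ext (e : seq bool) := exts [::] e.

Definition ext_rows : cmd := While 1 None (ext_row;; Pop 1;; clear 2).

Lemma run_ext_rows (R O W f g h : word) L M : size (flat L) <= M ->
  run ext_rows
    [:: R; flat L; [::]; [::]; [::]; O; W; f; g; h]
    (size (flat L) * (20 * M + 60) + 1)
    [:: R; [::]; [::]; [::]; [::]; rev (flat (flatten (map ext L))) ++ O; W; f; g; h].
Proof.
elim: L O => [|e L IH] O; first by move=> _; apply: run_While_stop.
rewrite flat_cons size_cat size_map /= => hM; apply: run_conv.
- apply: run_While_step; [by []|by case: (e)| |].
    by apply: run_Seq; [apply: (@run_ext_row _ _ _ _ _ _ _ _ [::] M); rewrite /=; lia|runs].
  apply: IH; lia.
- rewrite /= cats0 size_map size_rev; nia.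
- by rewrite flat_cat rev_cat catA.
Qed.

Definition ext_list : cmd := ext_rows;; move_until 5 None 1.

Lemma run_ext_list (R W f g h : word) L M : size (flat L) <= M ->
  run ext_list
    [:: R; flat L; [::]; [::]; [::]; [::]; W; f; g; h]
    (M * (20 * M + 60) + 5 * size (flat (flatten (map ext L))) + 10)
    [:: R; flat (flatten (map ext L)); [::]; [::]; [::]; [::]; W; f; g; h].
Proof.
move=> hM; apply: run_conv.
- by apply: run_Seq; [apply: run_ext_rows hM|run1].
- cbn [nth]; rewrite cats0 size_rev; nia.
- by rewrite /= !cats0 revK.
Qed.

(** * Comparison of candidates with the input rows *)

Definition violates (d a b : bool) := if d then a && ~~ b else b && ~~ a.

(* [e] below [s] if [d], above [s] otherwise, where [s] is padded with zeros. *)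
Fixpoint sub (d : bool) (e s : seq bool) : bool :=
  if e is a :: e' then ~~ violates d a (head false s) && sub d e' (behead s)
  else true.

Definition cmp_letter d : cmd :=
  let x := if d then 3 else 6 in let y := if d then 6 else 3 in
  If x (Some (Some true)) (If y (Some (Some true)) Skip (raise 8)) Skip.

(** Register 6 is not popped at a separator, and a separator is not read as 1: this is what pads a
    short row with zeros. *)
Definition cmp_step d : cmd :=
  cmp_letter d;; Pop 3;; If 6 (Some None) Skip (Pop 6).

Lemma run_cmp_step (R T P A B O W f h : word) d a b c :
  ohead W = Some c ->
  run (cmp_step d)
    [:: R; T; P; Some a :: A; B; O; W; f; flag b; h] 8
    [:: R; T; P; A; B; O; if c is None then W else behead W; f;
        flag (b || violates d a (odflt false c)); h].
Proof.
move=> hW; rewrite /cmp_step; apply: run_conv.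
- apply: run_Seq (_ : run _ _ 4 
    [:: R; T; P; Some a :: A; B; O; W; f; flag (b || violates d a (odflt false c)); h]) _.
    case: d; case: a; case: c hW => [[]|] hW; rewrite /violates /= ?orbF ?orbT;
    (apply: run_If_false => //=; try (by rewrite hW);
       by apply: run_le; [apply: run_Skip|]) ||
    (apply: run_If_true => //=; (try by rewrite hW);
      (apply: run_If_false => //=; try (by rewrite hW);
         by apply: run_raise) ||
      (apply: run_If_true => //=; try (by rewrite hW);
         by apply: run_le; [apply: run_Skip|])).
  apply: run_Seq (_ : run _ _ 1 _) _; first by run1.
  apply: (_ : run _ _ 2 
    [:: R; T; P; A; B; O; if c is None then W else behead W; f;
        flag (b || violates d a (odflt false c)); h]).
  case: c hW => [c|] hW.
    by apply: run_If_false => //=; [rewrite hW|run1].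
  by apply: run_If_true => //=; run1.
- by [].
- by [].
Qed.

Definition cmp_row d := While 3 None (cmp_step d).

Lemma run_cmp_row (R T P B O w f h : word) d e s b : size s <= size e ->
  run (cmp_row d)
    [:: R; T; P; bits e; B; O; bits s ++ None :: w; f; flag b; h]
    (9 * size e + 1)
    [:: R; T; P; [::]; B; O; None :: w; f; flag (b || ~~ sub d e s); h].
Proof.
elim: e s b => [|a e IH] [|c s] b //= hs.
- by rewrite orbF; apply: run_While_stop.
- apply: run_conv.
  + apply: run_While_step; [by []|by []| |exact: (IH [::] (b || violates d a false))].
    exact: (@run_cmp_step _ _ _ _ _ _ (None :: w) _ _ _ _ _ None).
  + lia.
  + by rewrite /= negb_and negbK orbA.
- apply: run_conv.
  + apply: run_While_step; [by []|by []| |exact: (IH s (b || violates d a c))].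
    exact: (@run_cmp_step _ _ _ _ _ _ (Some c :: _) _ _ _ _ _ (Some c)).
  + lia.
  + by rewrite /= negb_and negbK orbA.
Qed.

(** Register 8 records a violation by the current row, register 7 that some row so far has
    passed. *)
Definition test_row d : cmd :=
  copy 2 3;; cmp_row d;; Pop 6;; If 8 None (raise 7) Skip;; clear 8.

Lemma run_test_row (R T B O w h : word) d e s b : size s <= size e ->
  run (test_row d)
    [:: R; T; bits e; [::]; B; O; bits s ++ None :: w; flag b; [::]; h]
    (13 * size e + 20)
    [:: R; T; bits e; [::]; B; O; w; flag (b || sub d e s); [::]; h].
Proof.
move=> hs; apply: run_conv.
- apply: run_Seq; first by run1.
  apply: run_Seq; first (eapply (@run_cmp_row _ _ _ _ _ _ _ _ _ _ _ false hs)).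
  apply: run_Seq; first by run1.
  apply: run_Seq (_ : run _ _ 3 [:: R; T; bits e; [::]; B; O; w;
     flag (b || sub d e s); flag (~~ sub d e s); h]) _; last by run1.
  case: (sub d e s) => /=; rewrite ?orbT ?orbF.
    by apply: run_If_true => //; apply: run_raise.
  by apply: run_If_false => //; eapply run_le; [eapply run_Skip|].
- by cbn [nth]; rewrite size_map size_nseq; case: (sub _ _ _) => /=; lia.
- by [].
Qed.

Definition test_rows d := While 6 None (test_row d).

Lemma run_test_rows (R T B O h : word) d e L b : all (fun s => size s <= size e) L ->
  run (test_rows d)
    [:: R; T; bits e; [::]; B; O; flat L; flag b; [::]; h]
    (size (flat L) * (13 * size e + 21) + 1)
    [:: R; T; bits e; [::]; B; O; [::]; flag (b || has (sub d e) L); [::]; h].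
Proof.
elim: L b => [|s L IH] b /=; first by rewrite orbF => _; apply: run_While_stop.
case/andP=> hs hL; rewrite flat_cons; apply: run_conv.
- apply: run_While_step; [by []|by case: (s)|exact: run_test_row hs|exact: IH hL].
- rewrite size_cat /=; nia.
- by rewrite orbA.
Qed.

Definition filter_row d : cmd :=
  move_until 1 (Some None) 3;; Pop 1;; move_until 3 None 2;; copy 0 6;;
  test_rows d;; If 7 None (move_until 2 None 5;; Push 5 None) (clear 2);; clear 7.

(** For [d] true an accepted word is an uncovered set; for [d] false it is an independent set of the
    hypergraph whose edges are the rows. *)
Definition accept d (L : seq (seq bool)) (e : seq bool) := ~~ has (sub d e) L.

Lemma run_filter_row (T O h : word) d e L : all (fun s => size s <= size e) L ->
  run (filter_row d)
    [:: flat L; bits e ++ None :: T; [::]; [::]; [::]; O; [::]; [::]; [::]; h]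
    (size (flat L) * (13 * size e + 30) + 20 * size e + 20)
    [:: flat L; T; [::]; [::]; [::];
       rev (flat (filter (accept d L) [:: e])) ++ O; [::]; [::]; [::]; h].
Proof.
move=> hL; apply: run_conv.
- do 4! (apply: run_Seq; first by run1).
  rewrite !cats0 revK.
  apply: run_Seq; first exact: (@run_test_rows _ _ _ _ _ d e L false).
  apply: run_Seq (_ : run _ _ (5 * size e + 4) [:: flat L; T; [::]; [::]; [::];
    rev (flat (filter (accept d L) [:: e])) ++ O; [::];
    flag (has (sub d e) L); [::]; h]) _; last by run1.
  rewrite /accept /=; case: (has _ _) => /=.
    apply: run_le; first by apply: run_If_false => //; run1.
    by cbn [nth]; rewrite size_map; lia.
  apply: run_le.
    apply: run_If_true => //; apply: run_Seq; first by run1.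
    eapply run_Push; first by [].
    by rewrite /= flat_cons rev_cat.
  by cbn [nth]; rewrite size_map; lia.
- cbn [nth]; rewrite cats0 size_rev size_map size_nseq.
  by case: (has _ _); nia.
- by [].
Qed.

Definition filter_rows d := While 1 None (filter_row d).

Lemma run_filter_rows (O h : word) d N T L :
  all (fun s => size s <= N) L -> all (fun e => size e == N) T ->
  run (filter_rows d)
    [:: flat L; flat T; [::]; [::]; [::]; O; [::]; [::]; [::]; h]
    (size (flat T) * (size (flat L) * (13 * N + 30) + 20 * N + 30) + 1)
    [:: flat L; [::]; [::]; [::]; [::];
       rev (flat (filter (accept d L) T)) ++ O; [::]; [::]; [::]; h].
Proof.
move=> hL; elim: T O => [|e T IH] O /=; first by move=> _; apply: run_While_stop.
case/andP=> /eqP he hT; rewrite flat_cons; apply: run_conv.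
- apply: run_While_step; [by []|by case: (e)| |].
    by apply: run_filter_row; rewrite he.
  exact: IH hT.
- rewrite size_cat size_map /= he; nia.
- rewrite /=; case: (accept d L e) => //.
  by rewrite -[e :: filter _ _]cat1s flat_cat rev_cat -catA.
Qed.

Definition filter_list d : cmd := filter_rows d;; move_until 5 None 1.

Lemma run_filter_list (h : word) d N T L :
  all (fun s => size s <= N) L -> all (fun e => size e == N) T ->
  run (filter_list d)
    [:: flat L; flat T; [::]; [::]; [::]; [::]; [::]; [::]; [::]; h]
    (size (flat T) * (size (flat L) * (13 * N + 30) + 20 * N + 40) + 2)
    [:: flat L; flat (filter (accept d L) T); [::]; [::]; [::];
       [::]; [::]; [::]; [::]; h].
Proof.
move=> hL hT; apply: run_conv.
- by apply: run_Seq; [exact: run_filter_rows hL hT|run1].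
- cbn [nth]; rewrite cats0 size_rev.
  have : size (flat (filter (accept d L) T)) <= size (flat T).
    elim: (T) => //= e T' IH; case: ifP => _; rewrite !flat_cons !size_cat /=; lia.
  nia.
- by rewrite /= !cats0 revK.
Qed.

(** * The reduction map and its running time *)

Definition enc (n : nat) (L : seq (seq bool)) : word :=
  bits (nseq n true) ++ None :: flat L.

Definition grow : cmd := Push 1 (Some false);; Push 9 (Some true).

Definition start a : cmd :=
  Push 1 None;; While 0 (Some None) (Pop 0;; grow);; Pop 0;; iter a (Seq grow) Skip.

Lemma run_start a n L :
  run (start a)
    (enc n L :: nseq 9 [::])
    (4 * n + 2 * a + 4)
    [:: flat L; flat [:: nseq (n + a) false]; [::]; [::]; [::]; [::]; [::]; [::];
        [::]; bits (nseq (n + a) true)].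
Proof.
have nseq_bits b (i : nat) : bits (nseq i b) = nseq i (Some b) by apply: map_nseq.
rewrite /enc /flat /= cats0 -cats1 !nseq_bits.
have H1 i R T h : run (While 0 (Some None) (Pop 0;; grow))
  [:: nseq i (Some true) ++ None :: R; T; [::]; [::]; [::]; [::]; [::]; [::]; [::]; h]
  (4 * i + 1)
  [:: None :: R; nseq i (Some false) ++ T; [::]; [::]; [::]; [::]; [::]; [::]; [::];
     nseq i (Some true) ++ h].
  elim: i T h => [|i IH] T h; first by apply: run_While_stop.
  apply: run_conv.
  - by apply: run_While_step; [by []|by []|runs|exact: IH].
  - lia.
  - by rewrite -!(cat1s _ T) -!(cat1s _ h) !catA -!(nseqD _ 1) !addn1.
have H2 i R T h : run (iter i (Seq grow) Skip)
  [:: R; T; [::]; [::]; [::]; [::]; [::]; [::]; [::]; h]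
  (2 * i + 1)
  [:: R; nseq i (Some false) ++ T; [::]; [::]; [::]; [::]; [::]; [::]; [::];
     nseq i (Some true) ++ h].
  elim: i T h => [|i IH] T h; first exact: run_Skip.
  apply: run_conv.
  - by apply: run_Seq; [runs|exact: IH].
  - lia.
  - by rewrite -!(cat1s _ T) -!(cat1s _ h) !catA -!(nseqD _ 1) !addn1.
apply: run_conv.
- apply: run_Seq; first by run1.
  apply: run_Seq; first by apply: H1.
  apply: run_Seq; first by run1.
  by apply: H2.
- lia.
- by rewrite !cats0 catA -!nseqD addnC.
Qed.

Definition ext_all (L : seq (seq bool)) := flatten (map ext L).

(** One word for each [k]-tuple of positions. Setting a bit again changes nothing, so for positive
    [k] the supports are exactly the nonempty sets of at most [k] positions, with repetitions, which
    the encoding allows. *)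
Definition tuples k N := iter k ext_all [:: nseq N false].

Lemma size_exts p e : size (exts p e) = size e.
Proof. by elim: e p => //= b e IH p; rewrite IH. Qed.

Lemma all_size_exts p e : all (fun u => size u == size p + size e) (exts p e).
Proof.
elim: e p => //= b e IH p; rewrite size_cat size_rev /= eqxx /=.
by rewrite addnS -addSn; apply: (IH (b :: p)).
Qed.

Lemma all_size_ext_all N L : all (fun u => size u == N) L ->
  all (fun u => size u == N) (ext_all L).
Proof.
elim: L => //= e L IH /andP[/eqP he /IH hL].
by rewrite /ext_all /= all_cat hL andbT -he; apply: (all_size_exts [::]).
Qed.

Lemma size_ext_all N L : all (fun u => size u == N) L -> size (ext_all L) = size L * N.
Proof.
elim: L => //= e L IH /andP[/eqP he /IH hL].
by rewrite /ext_all /= size_cat -/(ext_all L) hL size_exts he mulSn.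
Qed.

Lemma all_size_tuples k N : all (fun u => size u == N) (tuples k N).
Proof.
by elim: k => [|k IH] /=; rewrite ?size_nseq ?eqxx //; apply: all_size_ext_all.
Qed.

Lemma size_tuples k N : size (tuples k N) = N ^ k.
Proof.
elim: k => //= k IH.
by rewrite (size_ext_all (all_size_tuples k N)) IH expnSr.
Qed.

Lemma size_flat N L : all (fun u => size u == N) L -> size (flat L) = size L * N.+1.
Proof.
elim: L => //= e L IH /andP[/eqP he /IH hL].
by rewrite flat_cons size_cat /= hL size_map he mulSn addSnnS.
Qed.

Lemma size_flat_tuples k N : size (flat (tuples k N)) = N ^ k * N.+1.
Proof. by rewrite (size_flat (all_size_tuples k N)) size_tuples. Qed.

(** All lists up to round [k] have length at most [b ^ k.+1], and a round is quadratic in that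
    length; hence the exponent [2 * k + 2]. *)
Lemma run_iter_ext k N b (R W f g h : word) : N < b ->
  run (iter k (Seq ext_list) Skip)
    [:: R; flat [:: nseq N false]; [::]; [::]; [::]; [::]; W; f; g; h]
    (k * (100 * b ^ (2 * k + 2)) + 1)
    [:: R; flat (tuples k N); [::]; [::]; [::]; [::]; W; f; g; h].
Proof.
move=> Nb; rewrite -[[:: nseq N false]]/(tuples 0 N).
suff H i j : i + j <= k -> run (iter i (Seq ext_list) Skip)
    [:: R; flat (tuples j N); [::]; [::]; [::]; [::]; W; f; g; h]
    (i * (100 * b ^ (2 * k + 2)) + 1)
    [:: R; flat (tuples (i + j) N); [::]; [::]; [::]; [::]; W; f; g; h].
  by have := H k 0; rewrite addn0; apply.
elim: i j => [|i IH] j hij; first exact: run_Skip.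
have b0 : 0 < b by lia.
have hM p : p <= k -> size (flat (tuples p N)) <= b ^ k.+1.
  move=> pk; rewrite size_flat_tuples expnSr leq_mul //.
  apply: (@leq_trans (b ^ p)); last by rewrite leq_pexp2l.
  by case: (p) => // q; rewrite leq_exp2r // ltnW.
apply: run_conv.
- apply: run_Seq; first by apply: run_ext_list (hM j _); lia.
  by apply: (IH j.+1); lia.
- have := hM j.+1; rewrite /= /ext_all => /(_ ltac:(lia)).
  have -> : 2 * k + 2 = k.+1 + k.+1 by lia.
  have : 0 < b ^ k.+1 by rewrite expn_gt0 b0.
  rewrite expnD; move: (b ^ _) (size _) => M s M0 hs; nia.
- by rewrite addnS.
Qed.

Definition reduce a k d : cmd :=
  start a;; iter k (Seq ext_list) Skip;; filter_list d;;
  Push 1 None;; move_until 9 None 1.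

Definition reduction a k d n L :=
  enc (n + a) (filter (accept d L) (tuples k (n + a))).

Lemma size_enc n L : size (enc n L) = n + (size (flat L)).+1.
Proof. by rewrite size_cat /= size_map size_nseq. Qed.

Lemma size_flat_filter (p : pred (seq bool)) L : size (flat (filter p L)) <= size (flat L).
Proof.
elim: L => //= e L IH; case: ifP => _; rewrite !flat_cons !size_cat /=; lia.
Qed.

Lemma run_reduce a k d (n : nat) L b : all (fun s => size s == n) L ->
  size (enc n L) + a + k + 100 <= b ->
  exists2 l, run (reduce a k d) (enc n L :: nseq 9 [::]) (b ^ (2 * k + 5)) l &
    [/\ nth [::] l 1 = reduction a k d n L, size l = 10
      & size (reduction a k d n L) + 2 <= b ^ (2 * k + 5)].
Proof.
rewrite size_enc => hL hb; set N := n + a.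
have Nb : N < b by lia.
have hT : size (flat (tuples k N)) <= b ^ k.+1.
  rewrite size_flat_tuples expnSr leq_mul //.
  by case: (k) => // q; rewrite leq_exp2r // ltnW.
have hM : b ^ k.+1 <= b ^ (2 * k + 2) by rewrite leq_pexp2l //; lia.
have hM1 : b <= b ^ (2 * k + 2) by rewrite -{1}[b]expn1 leq_pexp2l //; lia.
(* Filtering costs on the order of [b ^ 2] for each letter of the candidate list; the third factor
   [b], at least 100, absorbs the constants. *)
have -> : 2 * k + 5 = 3 + (2 * k + 2) by lia.
rewrite [b ^ _]expnD -[_ ^ 3]/(b * (b * b)).
have hN : all (fun s => size s <= N) L.
  by apply: sub_all hL => s /eqP->; apply: leq_addr.
exists [:: flat L; reduction a k d n L; [::]; [::]; [::]; [::]; [::]; [::]; [::]; [::]].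
  apply: run_conv.
  - apply: run_Seq; first exact: run_start.
    apply: run_Seq; first exact: run_iter_ext Nb.
    apply: run_Seq; first exact: (@run_filter_list _ d _ _ _ hN (all_size_tuples k N)).
    by runs.
  - cbn [nth]; rewrite size_map size_nseq -/N.
    move: (b ^ (2 * k + 2)) (size (flat (tuples k N))) (size (flat L)) hT hM hM1 hb.
    move: (b ^ _) => M1 M s t hT hM hM1 hb.
    have : s * (t * (13 * N + 30) + 20 * N + 40) <= M * (b * (13 * b + 30) + 20 * b + 40).
      apply: leq_mul; first lia.
      rewrite leq_add2r; apply: leq_add; [apply: leq_mul|]; lia.
    have : k * (100 * M) <= b * (100 * M) by apply: leq_mul; lia.
    nia.
  - by rewrite /= /reduction /enc /bits map_nseq rev_nseq.
split=> //; rewrite size_enc -/N.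
have := size_flat_filter (accept d L) (tuples k N).
have : 3 * b ^ (2 * k + 2) <= b * (b * b) * b ^ (2 * k + 2) by apply: leq_mul; nia.
lia.
Qed.

(** * Decoding of words, printing, and polynomial bounds *)

Lemma holds_init x : holds (x :: nseq 9 [::]) (init x).
Proof. by case=> [|i] // _; rewrite [RHS](nth_nseq [::] 9) if_same. Qed.

Lemma exec_output c x n l r : run c (x :: nseq 9 [::]) n l -> r < size l ->
  exists t s, [/\ exec (c;; Output r) (init x) t s, outputs t = [:: nth [::] l r]
    & size t <= n + (size (nth [::] l r) + 2)].
Proof.
move=> R rl; have [m [s [e le h]]] := R _ (@holds_init x).
exists (ticks m ++ rcons (ticks (size (regs s r)).+1) (Out (regs s r))), s.
rewrite -(h _ rl); split.
- exact: exec_Seq e (exec_Output _ _).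
- have o i : outputs (ticks i) = [::] by elim: i.
  by rewrite /outputs pmap_cat -cats1 pmap_cat -!/(outputs _) !o.
- by rewrite size_cat size_rcons !size_nseq; lia.
Qed.

Fixpoint splitw (w : word) : seq (seq bool) :=
  match w with
  | [::] => [:: [::]]
  | None :: w' => [::] :: splitw w'
  | Some b :: w' => (b :: head [::] (splitw w')) :: behead (splitw w')
  end.

Lemma splitw_row v w : splitw (bits v ++ None :: w) = v :: splitw w.
Proof. by elim: v => //= b v ->. Qed.

Lemma splitw_bits v : splitw (bits v) = [:: v].
Proof. by elim: v => //= b v ->. Qed.

Lemma splitw_enc n L y : splitw (enc n L ++ bits y) = nseq n true :: rcons L y.
Proof.
rewrite /enc -catA /= splitw_row; congr (_ :: _).
elim: L => [|r L IH]; first exact: splitw_bits.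
by rewrite flat_cons -catA /= splitw_row IH.
Qed.

(** A reduction is a function on all words, so the instance is recovered by total functions. [rows]
    drops the piece after the final separator: it is empty for an instance, and it is [y] for an
    instance followed by [y]. *)
Definition width (x : word) := size (head [::] (splitw x)).
Definition rows (x : word) :=
  if behead (splitw x) is r :: s then belast r s else [::].

Lemma width_enc n L y : width (enc n L ++ bits y) = n.
Proof. by rewrite /width splitw_enc /= size_nseq. Qed.

Lemma rows_enc n L y : rows (enc n L ++ bits y) = L.
Proof. by rewrite /rows splitw_enc; case: L => //= r L; rewrite belast_rcons. Qed.

Definition wf_enc x := exists n L, x = enc n L /\ all (fun s => size s == n) L.

Lemma polytime_reduction a k d :
  polytime_on wf_enc (fun x => reduction a k d (width x) (rows x)).
Proof.
exists (reduce a k d;; Output 1).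
exists (('X + (a + k + 101)%:P) ^+ (2 * k + 6))%R => _ [n [L [-> hL]]].
rewrite -[X in width X]cats0 -[X in rows X]cats0 (width_enc _ _ [::]).
rewrite (rows_enc _ _ [::]).
set b := size (enc n L) + (a + k + 101).
have [|l hl [El sl hs]] := @run_reduce a k d n L b hL; first by rewrite /b; lia.
have [|t [s [e o ht]]] := @exec_output _ _ _ _ 1 hl; first by rewrite sl.
exists t, s; split=> //; first by rewrite o El.
rewrite horner_exp hornerD hornerX hornerC natrXE -[GRing.add _ _]/b.
apply: leq_trans ht _; rewrite El.
have -> : 2 * k + 6 = (2 * k + 5).+1 by lia.
(* Computing and printing the result each take at most [b ^ (2 * k + 5)]; one more [b] pays for the
   factor 2. *)
rewrite expnS; have : 2 <= b by rewrite /b; lia.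
by move: (b ^ _) hs; nia.
Qed.

Definition print : cmd :=
  While 4 None (move_until 4 (Some None) 3;; Pop 4;; move_until 3 None 2;;
                (Output 2;; clear 2)).

Lemma outputs_cat t1 t2 : outputs (t1 ++ t2) = outputs t1 ++ outputs t2.
Proof. exact: pmap_cat. Qed.

Lemma outputs_ticks n : outputs (ticks n) = [::].
Proof. by elim: n. Qed.

Lemma exec_print s a b us c d e f g :
  holds [:: a; b; [::]; [::]; flat us; c; d; e; f; g] s ->
  exists t s', [/\ exec print s t s', outputs t = map bits us
    & size t <= 20 * size (flat us) + 1].
Proof.
elim: us s => [|u us IH] s h.
  by exists [:: Tick], s; split=> //; apply: exec_While_stop; rewrite (h 4).
have r1 : run (move_until 4 (Some None) 3;; Pop 4;; move_until 3 None 2)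
  [:: a; b; [::]; [::]; flat (u :: us); c; d; e; f; g] (10 * size u + 3)
  [:: a; b; bits u; [::]; flat us; c; d; e; f; g].
  rewrite flat_cons; apply: run_conv; first by runs.
  - by cbn [nth]; rewrite cats0 size_rev size_map; lia.
  - by rewrite /= !cats0 revK.
have r2 : run (clear 2)
  [:: a; b; bits u; [::]; flat us; c; d; e; f; g] (2 * size u + 1)
  [:: a; b; [::]; [::]; flat us; c; d; e; f; g].
  by apply: run_conv; [run1|cbn [nth]; rewrite size_map|].
have [m1 [s1 [e1 le1 h1]]] := r1 s h.
have [m2 [s2 [e2 le2 h2]]] := r2 s1 h1.
have [t [s' [e3 o3 l3]]] := IH _ h2.
have eo := exec_Output s1 2; rewrite (h1 2) //= in eo.
exists (Tick :: (ticks m1 ++ (rcons (ticks (size (bits u)).+1) (Out (bits u)) ++ ticks m2)) ++ t), s'.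
split.
- apply: exec_While_step e3; first by rewrite (h 4) // flat_cons; case: (u).
  (* [Seq] is nested to the right, so the run of the first three commands is split by inversion and
     regrouped in front of the output. *)
  have [] : exists sa sb ta tb, [/\ exec (move_until 4 (Some None) 3) s ta sa,
    exec (Pop 4) sa tb sb & exists2 tc, exec (move_until 3 None 2) sb tc s1 & ta ++ tb ++ tc = ticks m1].
    inversion_clear e1; inversion_clear H0; do 4 eexists; split; [exact: H|exact: H1|].
    by eexists; [exact: H2|].
  move=> sa [sb [ta [tb [ea eb [tc ec <-]]]]]; rewrite -!catA.
  apply: exec_Seq ea _; apply: exec_Seq eb _; apply: exec_Seq ec _.
  by apply: exec_Seq e2; rewrite /= in eo.
- rewrite -cat1s !outputs_cat !outputs_ticks -cats1 outputs_cat outputs_ticks o3 /=.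
  by [].
- rewrite flat_cons [size (bits _ ++ _)]size_cat /= !size_cat /= size_cat size_rcons !size_nseq size_map.
  move: l3 le1 le2; lia.
Qed.

Lemma gaps_from_le d0 t d : d \in gaps_from d0 t -> d <= d0 + size t.
Proof.
elim: t d0 => [|[|w] t IH] d0 /=.
- by rewrite inE => /eqP->; rewrite addn0.
- by move/IH; rewrite addSnnS.
- by rewrite inE => /orP[/eqP->|/IH]; lia.
Qed.

(** No gap exceeds the length of the whole trace, so it is enough to compute the complete list of
    solutions in polynomial time and then print it. *)
Lemma poly_delay_run (C : enum_problem) c K E :
  (forall x, inst C x -> exists us a,
    [/\ run c (x :: nseq 9 [::]) ((size x + K) ^ E)
          [:: a; [::]; [::]; [::]; flat us; [::]; [::]; [::]; [::]; [::]],
        uniq us, size (flat us) <= (size x + K) ^ E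
      & forall y, y \in map bits us <-> sols C x y]) ->
  poly_delay C.
Proof.
(* Printing takes at most 20 times the bound plus one, so everything takes at most 22 times the
   bound; an extra factor of a base at least 22 pays for this. *)
move=> H; exists (c;; print), (('X + (K + 22)%:P) ^+ E.+1)%R => x /H[us [a [r U le S]]].
have [m [s [e lem h]]] := r _ (@holds_init x).
have [t [s' [e' o let']]] := exec_print h.
exists (ticks m ++ t), s'; rewrite outputs_cat outputs_ticks o; split=> //.
- exact: exec_Seq e e'.
- by rewrite map_inj_uniq //; apply: inj_map => ? ? [].
move=> d /gaps_from_le; rewrite add0n size_cat size_nseq => ld.
rewrite horner_exp hornerD hornerX hornerC natrXE -[GRing.add _ _]/(size x + (K + 22)).
apply: leq_trans ld _; rewrite expnS.
have : (size x + K) ^ E <= (size x + (K + 22)) ^ E.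
  by case: (E) => // q; rewrite leq_exp2r // leq_add2l leq_addr.
have : 0 < (size x + (K + 22)) ^ E by rewrite expn_gt0 addnA addnS.
move: (_ ^ E) lem le let' => M lem le let'; move: (_ ^ E) => M' M0 lM.
have : 22 * M' <= (size x + (K + 22)) * M' by apply: leq_mul; lia.
lia.
Qed.

(** * Extraction of the vector appended to an instance *)

Definition take_last a : cmd :=
  move_until 0 None 1;; iter a (Seq (Pop 1)) Skip;; move_until 1 (Some None) 2;;
  move_until 1 None 0.

Lemma enc_rcons n L : exists E, enc n L = rcons E None.
Proof.
case/lastP: L => [|L r]; first by exists (bits (nseq n true)); rewrite -cats1.
exists (bits (nseq n true) ++ None :: flat L ++ bits r).
by rewrite /enc -!cats1 flat_cat flat_cons /= -!catA /= -catA.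
Qed.

(** Reversing the whole input brings the appended vector to the front: its last [size z] bits are
    popped, the rest up to the separator goes to 2 in the right order, and the instance returns to
    0. *)
Lemma run_take_last n L v z :
  let x := enc n L ++ bits (v ++ z) in
  run (take_last (size z)) (x :: nseq 9 [::]) (15 * size x + 4)
    [:: enc n L; [::]; bits v; [::]; [::]; [::]; [::]; [::]; [::]; [::]].
Proof.
have [E ->] := enc_rcons n L.
have H i (u A : word) : size u = i -> run (iter i (Seq (Pop 1)) Skip)
  [:: [::]; u ++ A; [::]; [::]; [::]; [::]; [::]; [::]; [::]; [::]] (i + 1)
  [:: [::]; A; [::]; [::]; [::]; [::]; [::]; [::]; [::]; [::]].
  elim: i u => [|i IH] [|b u] //= hs; first exact: run_Skip.
  by apply: run_conv; [apply: run_Seq; [run1|apply: (IH u); lia]|lia|].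
move=> x; apply: run_conv.
- apply: run_Seq; first by run1.
  rewrite /x /bits map_cat !rev_cat rev_rcons -!catA cats0.
  apply: run_Seq; first by apply: H; rewrite size_rev size_map.
  rewrite -map_rev -/(bits _).
  apply: run_Seq; first by run1.
  by run1.
- cbn [nth]; rewrite /x !size_cat /= !size_rev !size_map !size_cat size_rcons; lia.
- by rewrite /= !cats0 /bits map_rev revK rev_cons revK.
Qed.

Definition take_word a : cmd :=
  take_last a;; move_until 2 None 5;; Push 4 None;; move_until 5 None 4.

Lemma run_take_word n L v z :
  let x := enc n L ++ bits (v ++ z) in
  run (take_word (size z)) (x :: nseq 9 [::]) (30 * size x + 7)
    [:: enc n L; [::]; [::]; [::]; flat [:: v]; [::]; [::]; [::]; [::]; [::]].
Proof.
move=> x; apply: run_conv.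
- by apply: run_Seq; [exact: run_take_last|runs].
- cbn [nth]; rewrite -/x cats0 size_rev /x !size_cat !size_map !size_cat; lia.
- by rewrite /= cats0 revK flat_cons.
Qed.

Definition scan c : cmd :=
  While 3 None (If 3 (Some (Some c)) (raise (if c then 7 else 8)) Skip;; Pop 3).

Lemma run_scan (X P V B O r W : word) c v b7 b8 :
  run (scan c)
    [:: X; P; V; bits v; B; O; r; flag b7; flag b8; W] (5 * size v + 1)
    [:: X; P; V; [::]; B; O; r; flag (b7 || c && has id v);
        flag (b8 || ~~ c && has negb v); W].
Proof.
elim: v b7 b8 => [|a v IH] b7 b8 /=.
  by rewrite !andbF !orbF; apply: run_While_stop.
apply: run_conv.
- apply: run_While_step; [by []|by []| |].
    apply: run_Seq (_ : run _ _ 3 [:: X; P; V; Some a :: bits v; B; O; r;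
      flag (b7 || c && a); flag (b8 || ~~ c && ~~ a); W]) _; last by run1.
    case: c {IH}; case: a => /=; rewrite ?orbT ?orbF.
    + by apply: run_If_true => //; eapply run_raise.
    + by apply: run_If_false => //; eapply run_le; [eapply run_Skip|].
    + by apply: run_If_false => //; eapply run_le; [eapply run_Skip|].
    + by apply: run_If_true => //; eapply run_raise.
  exact: IH.
- lia.
- by rewrite -!orbA -!andb_orr.
Qed.

(* From here on: 1 holds the column index i as 1^i, 2 the number of remaining
   columns in unary, 6 the vector under construction, 9 the rows still to be read. *)

Definition emit : cmd :=
  copy 6 3;; scan true;; If 7 None (clear 6) (move_until 6 None 5;; Push 5 None);; clear 7.

(** The scan for a 1 discards the zero vector, which is never an answer. *)
Lemma run_emit (X P V B O W : word) r b :
  run emit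
    [:: X; P; V; [::]; B; O; bits r; [::]; flag b; W] (15 * size r + 20)
    [:: X; P; V; [::]; B; rev (flat (filter (has id) [:: r])) ++ O; [::]; [::]; flag b; W].
Proof.
apply: run_conv.
- apply: run_Seq; first by run1.
  apply: run_Seq; first eapply (@run_scan _ _ _ _ _ _ _ _ _ false).
  apply: run_Seq (_ : run _ _ (5 * size r + 4) [:: X; P; V; [::]; B;
    rev (flat (filter (has id) [:: r])) ++ O; [::]; flag (has id r); flag b; W]) _; last by run1.
  rewrite /= orbF; case: (has _ _) => /=.
    apply: run_le.
      apply: run_If_false => //; apply: run_Seq; first by run1.
      eapply run_Push; first by [].
      by rewrite /= flat_cons rev_cat.
    by cbn [nth]; rewrite size_map; lia.
  apply: run_le; first by apply: run_If_true => //; run1.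
  by cbn [nth]; rewrite size_map; lia.
- by cbn [nth]; rewrite size_map size_nseq; case: (has _ _); lia.
- by [].
Qed.

(** * Classes of equal columns *)

Fixpoint mark (b : bool) (s r : seq bool) : seq bool :=
  match s, r with
  | c :: s', q :: r' => (if c == b then q else true) :: mark b s' r'
  | _, _ => [::]
  end.

Definition mark_step b : cmd :=
  If 9 (Some (Some b)) (put_letter 6 4) (Push 4 (Some true));; Pop 6;; Pop 9.

Definition mark_row b : cmd :=
  While 9 (Some None) (mark_step b);; Pop 9;; move_until 4 None 6.

Lemma run_mark_row (X P V A O w f g : word) b s r : size s = size r ->
  run (mark_row b)
    [:: X; P; V; A; [::]; O; bits r; f; g; bits s ++ None :: w] (15 * size s + 4)
    [:: X; P; V; A; [::]; O; bits (mark b s r); f; g; w].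
Proof.
have H : forall B, size s = size r -> run (While 9 (Some None) (mark_step b))
    [:: X; P; V; A; B; O; bits r; f; g; bits s ++ None :: w] (8 * size s + 1)
    [:: X; P; V; A; rev (bits (mark b s r)) ++ B; O; [::]; f; g; None :: w].
  elim: s r => [|c s IH] [|q r] B //= E; first exact: run_While_stop.
  apply: run_conv.
  - apply: run_While_step; [by []|by []| |].
      apply: run_Seq (_ : run _ _ 4 [:: X; P; V; A; Some (if c == b then q else true) :: B;
        O; Some q :: bits r; f; g; Some c :: bits s ++ None :: w]) _; last by runs.
      have [->|/eqP cb] := eqVneq c b.
        apply: run_If_true => //; eapply run_put_letter; [by []|by []|side|side].
      apply: run_le; first by apply: run_If_false; [by []|case|run1].
      by [].
    by apply: IH; lia.
  - lia.
  - by rewrite rev_cons cat_rcons.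
move=> E; apply: run_conv.
- by apply: run_Seq; [exact: H E|runs].
- cbn [nth]; rewrite cats0 size_rev size_map.
  have -> : size (mark b s r) = size s.
    by elim: (s) (r) E => [|c s' IH] [|q r'] //= [E]; rewrite IH.
  lia.
- by rewrite /= !cats0 revK.
Qed.

Lemma size_mark b s r : size s = size r -> size (mark b s r) = size r.
Proof. by elim: s r => [|c s' IH] [|q r'] //= [E]; rewrite IH. Qed.

Definition skip_index : cmd := While 4 None (Pop 3;; Pop 4).

Lemma run_skip_index (X P V A O r f g W : word) i :
  run skip_index
    [:: X; P; V; A; bits (nseq i true); O; r; f; g; W] (3 * i + 1)
    [:: X; P; V; drop i A; [::]; O; r; f; g; W].
Proof.
elim: i A => [|i IH] A; first by rewrite drop0; apply: run_While_stop.
apply: run_conv.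
- by apply: run_While_step; [by []|by []|runs|exact: IH].
- lia.
- by case: A => [|a A] //=; rewrite drop_nil.
Qed.

(** The entry in column [i] is read by dropping [i] letters from a copy of the rows; a 0 there
    raises 7, the sign that the column is not constantly 1. *)
Definition col_row : cmd :=
  copy 9 3;; copy 1 4;; skip_index;;
  If 3 (Some (Some true)) (mark_row true) (raise 7;; mark_row false);; clear 3.

Lemma run_col_row (X V O w g : word) i s r b : size s = size r -> i < size r ->
  run col_row
    [:: X; bits (nseq i true); V; [::]; [::]; O; bits r; flag b; g; bits s ++ None :: w]
    (40 * (size s + size w) + 50)
    [:: X; bits (nseq i true); V; [::]; [::]; O; bits (mark (nth false s i) s r);
        flag (b || ~~ nth false s i); g; w].
Proof.
move=> E ir; rewrite -E in ir; apply: run_conv.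
- apply: run_Seq; first by run1.
  apply: run_Seq; first by run1.
  apply: run_Seq; first exact: run_skip_index.
  apply: run_Seq (_ : run _ _ (15 * size s + 7)
    [:: X; bits (nseq i true); V; drop i (bits s ++ None :: w); [::]; O;
       bits (mark (nth false s i) s r); flag (b || ~~ nth false s i); g; w]) _; last by run1.
  have D : drop i (bits s ++ None :: w) = Some (nth false s i) :: drop i.+1 (bits s ++ None :: w).
    rewrite (drop_nth None); last by rewrite size_cat size_map; lia.
    by rewrite nth_cat size_map ir (nth_map false).
  case Es: (nth false s i); rewrite Es in D.
    rewrite orbF; apply: run_le.
      by apply: run_If_true; [by []|rewrite /= D|exact: run_mark_row].
    lia.
  rewrite orbT; apply: run_le.
    apply: run_If_false; [by []|by rewrite /= D|].
    apply: run_Seq; first by eapply run_raise.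
    exact: run_mark_row.
  lia.
- cbn [nth]; rewrite size_cat !size_map size_nseq size_drop size_cat /= size_map; lia.
- by [].
Qed.

(** Each row marks the positions where it differs from its own entry [i]; starting from zeros, the
    positions marked in the end are the columns that differ from column [i]. *)
Definition columns (i : nat) (L : seq (seq bool)) (r : seq bool) :=
  foldl (fun r s => mark (nth false s i) s r) r L.

Definition col_rows := While 9 None col_row.

Lemma run_col_rows (X V O g : word) i L r b M : all (fun s => size s == size r) L ->
  i < size r -> size (flat L) <= M ->
  run col_rows
    [:: X; bits (nseq i true); V; [::]; [::]; O; bits r; flag b; g; flat L]
    (size (flat L) * (40 * M + 60) + 1)
    [:: X; bits (nseq i true); V; [::]; [::]; O; bits (columns i L r);
        flag (b || has (fun s => ~~ nth false s i) L); g; [::]].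
Proof.
move=> + ir; elim: L r b ir => [|s L IH] r b ir.
  by move=> _ _; rewrite orbF; apply: run_While_stop.
case/andP=> /eqP hs hL; rewrite flat_cons size_cat size_map /= => hM; apply: run_conv.
- apply: run_While_step; [by []|by case: (s)|exact: run_col_row hs ir|].
  by apply: IH; rewrite ?size_mark //; lia.
- rewrite addnS; nia.
- by rewrite orbA.
Qed.

(** A 0 among the first [i] letters reveals an earlier column equal to column [i], whose class has
    already been treated; register 8 reports it. *)
Definition check_first : cmd :=
  While 4 None (If 3 (Some (Some true)) Skip (raise 8);; Pop 3;; Pop 4).

Lemma run_check_first (X P V O q f W : word) i r b : i <= size r ->
  run check_first
    [:: X; P; V; bits r; bits (nseq i true); O; q; f; flag b; W] (6 * i + 1)
    [:: X; P; V; bits (drop i r); [::]; O; q; f; flag (b || ~~ all id (take i r)); W].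
Proof.
elim: i r b => [|i IH] r b; first by rewrite drop0 take0 orbF => _; apply: run_While_stop.
case: r => [|a r] //= ir; apply: run_conv.
- apply: run_While_step; [by []|by []| |exact: (IH r (b || ~~ a))].
  apply: run_Seq (_ : run _ _ 3 [:: X; P; V; Some a :: bits r;
    Some true :: bits (nseq i true); O; q; f; flag (b || ~~ a); W]) _; last by runs.
  case: a; rewrite ?orbT ?orbF.
    by apply: run_If_true => //; eapply run_le; [eapply run_Skip|].
  by apply: run_If_false => //; eapply run_raise.
- lia.
- by rewrite negb_and orbA.
Qed.

Definition zeros : cmd := While 3 None (Push 6 (Some false);; Pop 3).

Lemma run_zeros (X P V B O f g W : word) (i j : nat) :
  run zeros
    [:: X; P; V; bits (nseq i true); B; O; bits (nseq j false); f; g; W] (3 * i + 1)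
    [:: X; P; V; [::]; B; O; bits (nseq (i + j) false); f; g; W].
Proof.
elim: i j => [|i IH] j; first exact: run_While_stop.
apply: run_conv.
- apply: run_While_step; [by []|by []|runs|].
  exact: (IH j.+1).
- lia.
- by rewrite addnS.
Qed.

Definition select : cmd :=
  If 7 None (clear 6) (If 8 None (clear 7;; emit) (clear 6));; clear 7;; clear 8.

Lemma run_select (X P V O W : word) r b7 b8 :
  run select
    [:: X; P; V; [::]; [::]; O; bits r; flag b7; flag b8; W] (15 * size r + 40)
    [:: X; P; V; [::]; [::];
      rev (flat (filter (has id) (filter (fun=> b7 && ~~ b8) [:: r]))) ++ O;
      [::]; [::]; [::]; W].
Proof.
apply: run_conv.
- apply: run_Seq (_ : run _ _ (15 * size r + 25) [:: X; P; V; [::]; [::];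
      rev (flat (filter (has id) (filter (fun=> b7 && ~~ b8) [:: r]))) ++ O;
      [::]; flag (b7 && b8); flag b8; W]) _; last by runs.
  case: b7; case: b8.
  + apply: run_le.
      by apply: run_If_false => //; apply: run_If_false => //; run1.
    by cbn [nth]; rewrite size_map; lia.
  + apply: run_le.
      apply: run_If_false => //; apply: run_If_true => //.
      by apply: run_Seq; [run1|eapply (@run_emit _ _ _ _ _ _ _ false)].
    by cbn [nth]; rewrite /=; lia.
  + apply: run_le; first by apply: run_If_true => //; run1.
    by cbn [nth]; rewrite size_map; lia.
  + apply: run_le; first by apply: run_If_true => //; run1.
    by cbn [nth]; rewrite size_map; lia.
- by cbn [nth]; rewrite !size_nseq; case: b7; case: b8; lia.
- by [].
Qed.

(** The number [n] is present only as the sum of the counters in 1 and 2, so two calls of [zeros]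
    build the initial vector. *)
Definition class_step : cmd :=
  copy 1 3;; zeros;; copy 2 3;; zeros;; copy 0 9;; col_rows;;
  copy 6 3;; copy 1 4;; check_first;; clear 3;; select;; Push 1 (Some true);; Pop 2.

Definition coclass n L i := columns i L (nseq n false).

(** Each class is represented by its first column, and the class of columns that are constantly 1 is
    left out. *)
Definition selected n L i :=
  has (fun s => ~~ nth false s i) L && all id (take i (coclass n L i)).

Lemma size_columns i L r : all (fun s => size s == size r) L -> size (columns i L r) = size r.
Proof.
elim: L r => //= s L IH r /andP[/eqP hs hL].
by rewrite IH size_mark.
Qed.

Lemma run_class_step (O : word) (i m : nat) L M :
  all (fun s => size s == i + m.+1) L -> size (flat L) <= M -> i + m.+1 <= M ->
  run class_step
    [:: flat L; bits (nseq i true); bits (nseq m.+1 true); [::]; [::]; O;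
        [::]; [::]; [::]; [::]]
    (M * (40 * M + 60) + 100 * M + 100)
    [:: flat L; bits (nseq i.+1 true); bits (nseq m true); [::]; [::];
        rev (flat (filter (has id) [seq coclass (i + m.+1) L j | j <- [:: i]
                                     & selected (i + m.+1) L j])) ++ O;
        [::]; [::]; [::]; [::]].
Proof.
set n := i + m.+1 => hL hM hn; have i_n : i < n by rewrite /n; lia.
have sr : all (fun s => size s == size (nseq n false)) L by rewrite size_nseq.
have sc : size (coclass n L i) = n by rewrite size_columns ?size_nseq.
apply: run_conv.
- apply: run_Seq; first by run1.
  apply: run_Seq; first by eapply (@run_zeros _ _ _ _ _ _ _ _ i 0).
  apply: run_Seq; first by run1.
  apply: run_Seq; first exact: (@run_zeros _ _ _ _ _ _ _ _ m.+1 (i + 0)).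
  rewrite addn0 addnC -/n.
  apply: run_Seq; first by run1.
  apply: run_Seq.
    by eapply (@run_col_rows _ _ _ _ _ _ _ false M sr); rewrite ?size_nseq.
  rewrite -/(coclass n L i).
  apply: run_Seq; first by run1.
  apply: run_Seq; first by run1.
  apply: run_Seq.
    by eapply (@run_check_first _ _ _ _ _ _ _ _ _ false); rewrite sc ltnW.
  apply: run_Seq; first by run1.
  apply: run_Seq; first by eapply run_select.
  by runs.
- cbn [nth]; rewrite !size_map size_drop sc !size_nseq.
  have : size (flat L) * (40 * M + 60) <= M * (40 * M + 60) by apply: leq_mul.
  lia.
- rewrite /= negbK -/(selected n L i).
  by case: (selected _ _ _).
Qed.

Definition class_loop := While 2 None class_step.

Lemma run_class_loop (O : word) (i m : nat) L M :
  all (fun s => size s == i + m) L -> size (flat L) <= M -> i + m <= M ->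
  run class_loop
    [:: flat L; bits (nseq i true); bits (nseq m true); [::]; [::]; O;
        [::]; [::]; [::]; [::]]
    (m * (M * (40 * M + 60) + 100 * M + 101) + 1)
    [:: flat L; bits (nseq (i + m) true); [::]; [::]; [::];
        rev (flat (filter (has id) [seq coclass (i + m) L j | j <- iota i m
                                     & selected (i + m) L j])) ++ O;
        [::]; [::]; [::]; [::]].
Proof.
elim: m i O => [|m IH] i O hL hM hn.
  by rewrite addn0; apply: run_While_stop.
apply: run_conv.
- apply: run_While_step; [by []|by []|exact: run_class_step hL hM hn|].
  by apply: IH => //; rewrite addSnnS.
- lia.
- rewrite addSnnS [iota i m.+1]/= -(cat1s i (iota _ _)) filter_cat map_cat filter_cat.
  by rewrite flat_cat rev_cat catA.
Qed.

(** * Answers obtained from one maximal independent set *)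

Definition solve a : cmd :=
  take_last a;; copy 2 3;; scan false;;
  If 8 None
    (While 0 (Some None) (Pop 0);; Pop 0;; class_loop;; clear 1)
    (copy 2 6;; emit;; clear 2;; clear 8);;
  move_until 5 None 4.

(** The vector of ones is itself no answer: it stands for the case where every set is covered and
    the answers are the coclasses. *)
Definition solutions n L (v : seq bool) :=
  filter (has id)
    (if all id v then [seq coclass n L i | i <- iota 0 n & selected n L i] else [:: v]).

Lemma run_solve n L v z b : all (fun s => size s == n) L -> size v = n ->
  let x := enc n L ++ bits (v ++ z) in size x + 100 <= b ->
  exists X, run (solve (size z)) (x :: nseq 9 [::]) (b ^ 5)
    [:: X; [::]; [::]; [::]; flat (solutions n L v); [::]; [::]; [::]; [::]; [::]]
  /\ size (flat (solutions n L v)) <= b ^ 5.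
Proof.
move=> hL sv x hb.
have hx : n + (size (flat L)).+1 + (n + size z) + 100 <= b.
  by move: hb; rewrite /x size_cat size_enc size_map size_cat sv.
have hb5 : b ^ 5 = b * b * (b * b * b) by rewrite !expnS; lia.
have sol : size (flat (solutions n L v)) <= b * b.
  apply: leq_trans (size_flat_filter _ _) _.
  rewrite (@size_flat n).
    have : size (if all id v then [seq coclass n L i | i <- iota 0 n & selected n L i]
                 else [:: v]) <= n.+1.
      case: ifP => // _; rewrite size_map size_filter.
      by apply: leq_trans (count_size _ _) _; rewrite size_iota.
    by move=> h; apply: leq_mul; lia.
  case: ifP => _ /=; last by rewrite sv eqxx.
  by apply/allP => _ /mapP[i _ ->]; rewrite size_columns ?size_nseq.
exists (if all id v then flat L else enc n L); split; last first.
  by rewrite hb5; apply: leq_trans sol (leq_pmulr _ _); rewrite !muln_gt0; lia.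
have H (X : word) i : run (While 0 (Some None) (Pop 0))
  [:: bits (nseq i true) ++ None :: X; [::]; bits v; [::]; [::]; [::]; [::]; [::]; [::]; [::]]
  (2 * i + 1)
  [:: None :: X; [::]; bits v; [::]; [::]; [::]; [::]; [::]; [::]; [::]].
  elim: i => [|i IH]; first exact: run_While_stop.
  by apply: run_conv; [apply: run_While_step; [by []|by []|run1|exact: IH]|lia|].
apply: run_conv.
- apply: run_Seq; first exact: run_take_last.
  apply: run_Seq; first by run1.
  apply: run_Seq; first eapply (@run_scan _ _ _ _ _ _ _ _ _ false false).
  apply: run_Seq (_ : run _ _ (b * (b * (40 * b + 60) + 200 * b + 200))
    [:: if all id v then flat L else enc n L; [::]; [::]; [::]; [::];
      rev (flat (solutions n L v)); [::]; [::]; [::]; [::]]) _; last by run1.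
  rewrite /= has_predC /solutions; case: (boolP (all id v)) => [va|_].
    (* Being [n] ones, [v] already is the unary counter of remaining columns that the loop expects
       in register 2. *)
    have Ev : v = nseq n true.
      by rewrite -sv; apply/all_pred1P; apply: sub_all va => -[].
    apply: run_le.
      apply: run_If_true; [by []|by []|].
      apply: run_Seq; first exact: H.
      apply: run_Seq; first by run1.
      apply: run_Seq.
        rewrite Ev; eapply (@run_class_loop _ 0 n L b) => //; lia.
      eapply run_clear; first by [].
      by rewrite /= add0n cats0.
    cbn [nth]; rewrite size_map size_nseq add0n.
    have : n * (b * (40 * b + 60) + 100 * b + 101) <= b * (b * (40 * b + 60) + 100 * b + 101).
      by apply: leq_mul; lia.
    nia.
  apply: run_le.
    apply: run_If_false; [by []|by []|].
    apply: run_Seq; first by run1.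
    apply: run_Seq; first by eapply (@run_emit _ _ _ _ _ _ _ true).
    apply: run_Seq; first by run1.
    eapply run_clear; first by [].
    by rewrite /= cats0.
  by cbn [nth]; rewrite size_map sv /=; nia.
- cbn [nth]; rewrite size_map sv size_rev -/x hb5.
  (* The class loop is cubic; two more powers of [b], at least 100, absorb all constants. *)
  have : 600 * (b * b * b) <= b * b * (b * b * b) by apply: leq_mul => //; nia.
  have : b * (b * (40 * b + 60) + 200 * b + 200) <= 500 * (b * b * b) by nia.
  have : b * b <= b * b * b by apply: leq_pmulr; lia.
  have : b <= b * b by apply: leq_pmulr; lia.
  lia.
- by rewrite /= cats0 revK.
Qed.
End Programs.

(** * The closure under S12 *)

Section Closure.
Variables (k n : nat).
Hypothesis k_gt0 : 0 < k.
Implicit Types (S : {set n.-tuple bool}) (V K : {set 'I_n}) (v w : n.-tuple bool).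

Definition supp v : {set 'I_n} := [set i | tnth v i].

Definition covered S K := [exists s in S, K \subset supp s].

(** The empty [K] is excluded, so the empty set is [covb] even for empty [S], and the hyperedges
    made of uncovered sets are nonempty. *)
Definition covb S V :=
  [forall K : {set 'I_n}, [&& K != set0, #|K| <= k & K \subset V] ==> covered S K].

Lemma covbP S V :
  reflect (forall K, K != set0 -> #|K| <= k -> K \subset V ->
             exists2 s, s \in S & K \subset supp s)
          (covb S V).
Proof.
apply: (iffP forallP) => [h K K0 Kk KV | h K].
  by have /implyP := h K; rewrite K0 Kk KV => /(_ isT) /exists_inP.
by apply/implyP => /and3P[K0 Kk KV]; apply/exists_inP; apply: h.
Qed.

Lemma suppK v : charvec (supp v) = v.
Proof. by apply: eq_from_tnth => i; rewrite tnth_mktuple inE. Qed.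

Lemma charvecK V : supp (charvec V) = V.
Proof. by apply/setP => i; rewrite inE tnth_mktuple. Qed.

Lemma vec_leP v w : vec_le v w <-> supp v \subset supp w.
Proof.
split=> [h | /subsetP h i vi]; last by have := h i; rewrite !inE; apply.
by apply/subsetP => i; rewrite !inE; apply: h.
Qed.

Lemma supp_eq0 v : (v <> [tuple false | _ < n]) <-> supp v != set0.
Proof.
split=> [h | /set0Pn[i]]; last by rewrite inE => vi Ev; move: vi; rewrite Ev tnth_mktuple.
apply/negP => /eqP v0; apply: h; apply: eq_from_tnth => i; rewrite tnth_mktuple.
by apply/negbTE/negP => vi; have := in_set0 i; rewrite -v0 inE vi.
Qed.

Lemma supp_eqT v : (v <> [tuple true | _ < n]) <-> supp v != setT.
Proof.
split=> [h | h Ev].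
  apply/negP => /eqP vT; apply: h; apply: eq_from_tnth => i; rewrite tnth_mktuple.
  by have := in_setT i; rewrite -vT inE.
by case/negP: h; apply/eqP/setP => i; rewrite Ev !inE tnth_mktuple.
Qed.

Lemma card_falses m (x : m.-tuple bool) : #|[set i | ~~ tnth x i]| = m - count id x.
Proof.
have -> : m - count id x = count negb x.
  have : count id x + count negb x = m by rewrite -[RHS](size_tuple x) -(count_predC id).
  lia.
by rewrite -sum1_count big_tuple -sum1dep_card.
Qed.

Lemma card_trues m (x : m.-tuple bool) : #|[set i | tnth x i]| = count id x.
Proof.
by rewrite -sum1_count big_tuple -sum1dep_card.
Qed.

(* Invariance of the relation {0,1}^k \ {(1, ..., 1)}. *)
Lemma S12_common m (f : op m) : S12 k f ->
  forall X : seq (m.-tuple bool), size X <= k -> all f X ->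
  exists i, all (fun x => tnth x i) X.
Proof.
elim=> {m f} [m f|m i|m p f g _ IHf _ IHg] => [[]||] X hX.
- move=> fX.
  (* An input accepted by [Th k] has at most one false coordinate among [k.+1], so at most [k] such
     inputs leave a coordinate where all are true. *)
  have hc : #|[set i | has (fun x => ~~ tnth x i) X]| <= size X.
    elim: X fX {hX} => [|x X IH] /=.
      by move=> _; rewrite leqn0 cards_eq0; apply/eqP/setP => i; rewrite !inE.
    rewrite ffunE => /andP[hx /IH hX].
    have -> : [set i | ~~ tnth x i || has (fun x => ~~ tnth x i) X] =
      [set i | ~~ tnth x i] :|: [set i | has (fun x => ~~ tnth x i) X].
      by apply/setP => i; rewrite !inE.
    apply: leq_trans (leq_card_setU _ _) _; rewrite card_falses; lia.
  have : ~~ [forall i : 'I_k.+1, has (fun x => ~~ tnth x i) X].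
    apply/negP => /forallP h.
    have : #|[set i : 'I_k.+1 | has (fun x => ~~ tnth x i) X]| = k.+1.
      by rewrite -[RHS]card_ord -cardsT; congr #|pred_of_set _|; apply/setP => i; rewrite !inE h.
    by move=> hT; move: (leq_trans hc hX); rewrite hT ltnn.
  rewrite negb_forall => /existsP[i]; rewrite -all_predC => hi; exists i.
  by apply: sub_all hi => x /=; rewrite negbK.
(* The operation lies below its first argument. *)
- move=> /allP fX; exists ord0; apply/allP => x /fX; rewrite ffunE => /andP[+ _].
  by rewrite (tnth_nth false).
- by move=> /allP fX; exists i; apply/allP => x /fX; rewrite ffunE.
- move=> fX.
  have [||i hi] := IHf [seq [tuple g i x | i < m] | x <- X].
  + by rewrite size_map.
  + by rewrite all_map; apply: sub_all fX => x /=; rewrite ffunE.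
  apply: (IHg i) => //; move: hi; rewrite all_map; apply: sub_all => x /=.
  by rewrite tnth_mktuple.
Qed.

Lemma S12_true m (f : op m) : S12 k f -> f [tuple true | _ < m].
Proof.
elim=> {m f} [m f [] | m i | m p f g _ IHf _ IHg]; rewrite ffunE.
- rewrite -card_trues; apply: leq_trans (leqnSn k) _.
  rewrite -[X in X <= _]card_ord -cardsT; apply: subset_leq_card.
  by apply/subsetP => i _; rewrite inE tnth_mktuple.
- have nthT (i : 'I_3) : nth false [tuple true | _ < 3] i = true by rewrite nth_mktuple.
  by rewrite (nthT (@Ordinal 3 0 isT)) (nthT (@Ordinal 3 2 isT)) implybT.
- by rewrite tnth_mktuple.
- suff -> : [tuple g i [tuple true | _ < p] | i < m] = [tuple true | _ < m] by [].
  by apply: eq_from_tnth => i; rewrite !tnth_mktuple IHg.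
Qed.

(** * Constraints satisfied by the closure *)

Variable S : {set n.-tuple bool}.

(** The argument tuples at the coordinates in [K] are at most [k] inputs on which [f] is true; by
    [S12_common] some argument is 1 on all of [K], and the induction goes on with that argument. *)
Lemma Cl_covb v : Cl (S12 k) S v -> covb S (supp v).
Proof.
move=> Cv; apply/covbP => K _.
elim: Cv K => [{}v vS|m f u Ff _ IH] K Kk KV; first by exists v.
have [||j hj] := S12_common Ff (X := [seq [tuple tnth (u j) i | j < m] | i <- enum K]).
- by rewrite size_map -cardE.
- rewrite all_map; apply/allP => i; rewrite mem_enum => /(subsetP KV).
  by rewrite inE tnth_mktuple.
apply: (IH j) => //; apply/subsetP => i iK; rewrite inE.
move: hj; rewrite all_map => /allP/(_ i); rewrite mem_enum => /(_ iK) /=.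
by rewrite tnth_mktuple.
Qed.

Lemma Cl_const v i : Cl (S12 k) S v -> (forall s, s \in S -> tnth s i) -> tnth v i.
Proof.
elim=> [{}v vS|m f u Ff _ IH] h; first exact: h.
rewrite tnth_mktuple; suff -> : [tuple tnth (u j) i | j < m] = [tuple true | _ < m].
  exact: S12_true.
by apply: eq_from_tnth => j; rewrite !tnth_mktuple IH.
Qed.

Lemma Cl_eq_columns v i j : Cl (S12 k) S v ->
  (forall s, s \in S -> tnth s i = tnth s j) -> tnth v i = tnth v j.
Proof.
elim=> [{}v vS|m f u Ff _ IH] h; first exact: h.
rewrite !tnth_mktuple; congr (f _).
by apply: eq_from_tnth => l; rewrite !tnth_mktuple IH.
Qed.

(** For the empty list, [S12_common] says that an operation of the clone has at least one argument,
    so the empty set generates nothing. *)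
Lemma Cl_nonempty v : Cl (S12 k) S v -> exists s, s \in S.
Proof.
elim=> [{}v vS|m f u Ff _ IH]; first by exists v.
by have [|//|j _] := S12_common Ff (X := [::]); last exact: IH.
Qed.

Lemma Cl_and_imp x y z w : Cl (S12 k) S x -> Cl (S12 k) S y -> Cl (S12 k) S z ->
  (forall i, tnth w i = tnth x i && (tnth y i ==> tnth z i)) -> Cl (S12 k) S w.
Proof.
move=> Cx Cy Cz hw.
pose u (j : 'I_3) := nth x [:: x; y; z] j.
suff -> : w = [tuple and_imp [tuple tnth (u j) i | j < 3] | i < n].
  apply: Cl_op; first by apply: clone_gen; constructor.
  by move=> [[|[|[|]]] hj] //.
apply: eq_from_tnth => i; rewrite hw tnth_mktuple ffunE.
have nthu (j : 'I_3) : nth false [tuple tnth (u j) i | j < 3] j = tnth (u j) i.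
  by rewrite nth_mktuple.
by rewrite (nthu (@Ordinal 3 0 isT)) (nthu (@Ordinal 3 1 isT)) (nthu (@Ordinal 3 2 isT)).
Qed.

Lemma Cl_Th (u : 'I_k.+1 -> n.-tuple bool) w : (forall j, Cl (S12 k) S (u j)) ->
  (forall i, tnth w i = (k <= #|[set j | tnth (u j) i]|)) -> Cl (S12 k) S w.
Proof.
move=> Cu hw.
suff -> : w = [tuple Th k [tuple tnth (u j) i | j < k.+1] | i < n].
  by apply: Cl_op Cu; apply: clone_gen; constructor.
apply: eq_from_tnth => i; rewrite hw tnth_mktuple ffunE -card_trues.
by congr (_ <= #|pred_of_set _|); apply/setP => j; rewrite !inE tnth_mktuple.
Qed.

(** * Sufficiency of the constraints *)

Section Complete.
Variable v : n.-tuple bool.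
Hypothesis const_v : forall i, ~~ tnth v i -> exists2 s, s \in S & ~~ tnth s i.
Hypothesis eq_v : forall i j, ~~ tnth v i -> tnth v j ->
  exists2 s, s \in S & tnth s i != tnth s j.

(** [J] is treated one element at a time: [a] keeps the earlier ones, [b] keeps the new [j], both
    lie below [x] and omit [i], and so does their join, which the implication expresses below
    [x]. *)
Lemma separate x i (J : seq 'I_n) : Cl (S12 k) S x -> ~~ tnth v i ->
  all (tnth v) J ->
  exists w, [/\ Cl (S12 k) S w, vec_le w x, ~~ tnth w i
    & forall j, j \in J -> tnth x j -> tnth w j].
Proof.
move=> Cx vi; elim: J => [_|j J IH /= /andP[vj /IH[a [Ca ax ai aJ]]]].
  have [z zS zi] := const_v vi; have Cz := Cl_base (S12 k) zS.
  exists [tuple tnth x l && (tnth x l ==> tnth z l) | l < n]; split=> //.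
  - by apply: (Cl_and_imp Cx Cx Cz) => l; rewrite tnth_mktuple.
  - by move=> l; rewrite tnth_mktuple => /andP[].
  - by rewrite tnth_mktuple (negPf zi); case: (tnth x i).
have [b [Cb bx bi bj]] : exists b, [/\ Cl (S12 k) S b, vec_le b x, ~~ tnth b i
    & tnth x j -> tnth b j].
  have [t tS] := eq_v vi vj; have Ct := Cl_base (S12 k) tS.
  case ti: (tnth t i); case tj: (tnth t j) => // _.
    (* Here [t] is 1 at [i] and 0 at [j]: x /\ (t -> z) drops [i] and keeps [j]. *)
    have [z zS zi] := const_v vi; have Cz := Cl_base (S12 k) zS.
    exists [tuple tnth x l && (tnth t l ==> tnth z l) | l < n]; split.
    - by apply: (Cl_and_imp Cx Ct Cz) => l; rewrite tnth_mktuple.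
    - by move=> l; rewrite tnth_mktuple => /andP[].
    - by rewrite tnth_mktuple (negPf zi) ti andbF.
    - by move=> xj; rewrite tnth_mktuple tj xj.
  (* Here [t] is 0 at [i] and 1 at [j]: the meet of [x] and [t], written x /\ (x -> t), is
     enough. *)
  exists [tuple tnth x l && (tnth x l ==> tnth t l) | l < n]; split.
  - by apply: (Cl_and_imp Cx Cx Ct) => l; rewrite tnth_mktuple.
  - by move=> l; rewrite tnth_mktuple => /andP[].
  - by rewrite tnth_mktuple ti; case: (tnth x i).
  - by move=> xj; rewrite tnth_mktuple tj xj.
have Cab : Cl (S12 k) S [tuple tnth x l && (tnth a l ==> tnth b l) | l < n].
  by apply: (Cl_and_imp Cx Ca Cb) => l; rewrite tnth_mktuple.
(* x /\ (a \/ b) = x /\ ((x /\ (a -> b)) -> b) *)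
exists [tuple tnth x l && (tnth a l || tnth b l) | l < n]; split.
- apply: (Cl_and_imp Cx Cab Cb) => l; rewrite !tnth_mktuple.
  by case: (tnth x l); case: (tnth a l); case: (tnth b l).
- by move=> l; rewrite tnth_mktuple => /andP[].
- by rewrite tnth_mktuple (negPf ai) (negPf bi) andbF.
move=> l; rewrite inE tnth_mktuple => /orP[/eqP->|lJ] xl; rewrite xl /=.
  by rewrite bj ?orbT.
by rewrite aJ.
Qed.

(** The coordinates outside [v] are removed one after the other by [separate], each time keeping
    [K]. *)
Lemma restrict x K : Cl (S12 k) S x -> K \subset supp v -> K \subset supp x ->
  exists w, [/\ Cl (S12 k) S w, vec_le w v & K \subset supp w].
Proof.
move=> Cx Kv Kx.
have [w [Cw Kw wv]] : exists w, [/\ Cl (S12 k) S w, K \subset supp w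
    & forall i, i \in enum 'I_n -> ~~ tnth v i -> ~~ tnth w i].
  elim: (enum _) => [|i I [w [Cw Kw wI]]]; first by exists x.
  case vi: (tnth v i).
    by exists w; split=> // j; rewrite inE => /orP[/eqP->|/wI] //; rewrite vi.
  have [||u [Cu uw ui uK]] := @separate w i (enum K) Cw; first by rewrite vi.
    by apply/allP => j; rewrite mem_enum => /(subsetP Kv); rewrite inE.
  exists u; split=> //.
    apply/subsetP => j jK; rewrite inE; apply: uK; first by rewrite mem_enum.
    by have := subsetP Kw _ jK; rewrite inE.
  move=> j; rewrite inE => /orP[/eqP->|/wI h] // /h; apply: contra; exact: uw.
exists w; split=> // i; apply: contraTT; apply: wv; exact: mem_enum.
Qed.

(** Baker-Pixley argument, by induction on the size of [K]. Sets of at most [k] elements come from a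
    covering member of [S] cut down by [restrict]; a larger set is glued by [Th k] from vectors
    containing it up to one of [k.+1] chosen points. The case where [K] is the support of [v] gives
    [v] itself. *)
Lemma Cl_complete : (exists s, s \in S) -> covb S (supp v) -> Cl (S12 k) S v.
Proof.
move=> [s0 s0S] /covbP cov.
have H m K : #|K| <= m -> K \subset supp v ->
    exists w, [/\ Cl (S12 k) S w, vec_le w v & K \subset supp w].
  have base K' : #|K'| <= k -> K' \subset supp v ->
      exists w, [/\ Cl (S12 k) S w, vec_le w v & K' \subset supp w].
    move=> K'k K'v; have [K0|/cov] := eqVneq K' set0.
      by apply: (restrict (Cl_base _ s0S)); rewrite // K0 sub0set.
    case=> // s sS K's; exact: (restrict (Cl_base _ sS)).
  elim: m K => [|m IH] K Km Kv; first by apply: base Kv; lia.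
  have [Kk|kK] := leqP #|K| k; first exact: base.
  have [x0 x0K] : exists x, x \in K by apply/set0Pn; rewrite -card_gt0; lia.
  pose e (j : 'I_k.+1) := nth x0 (enum K) j.
  have eK j : e j \in K by rewrite -mem_enum mem_nth // -cardE; have := ltn_ord j; lia.
  have e_inj : injective e.
    have lt_e (i : 'I_k.+1) : i < size (enum K) by rewrite -cardE; have := ltn_ord i; lia.
    by move=> i j /eqP; rewrite nth_uniq ?enum_uniq // => /eqP/val_inj.
  have hex (p : 'I_k.+1) : exists w, [/\ Cl (S12 k) S w, vec_le w v
      & K :\ e p \subset supp w].
    apply: IH; last by apply: subset_trans Kv; apply: subsetDl.
    by have := cardsD1 (e p) K; rewrite eK; lia.
  have [u hu] := fin_all_exists hex.
  exists (mktuple (fun i => k <= #|[set j | tnth (u j) i]|)); split.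
  - by apply: (@Cl_Th u) => [j|i]; [case: (hu j)|rewrite tnth_mktuple].
  (* As [k] is positive, a 1 of the result is a 1 of some [u j], which lies below [v]. *)
  - move=> i; rewrite tnth_mktuple => ki.
    have : [set j | tnth (u j) i] != set0 by rewrite -card_gt0 (leq_trans _ ki).
    by case/set0Pn=> j; rewrite inE; case: (hu j) => _ + _; apply.
  apply/subsetP => i iK; rewrite inE tnth_mktuple.
  (* A point of [K] can be missing only from the vector whose removed point it is, so at least [k]
     of the [k.+1] vectors contain it. *)
  have : #|[set j | ~~ tnth (u j) i]| <= 1.
    apply/card_le1_eqP => j l; rewrite !inE => uj ul; apply: e_inj.
    have hi p : ~~ tnth (u p) i -> e p = i.
      move=> up; apply/eqP; apply: contraR up => ei; case: (hu p) => _ _ /subsetP/(_ i).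
      by rewrite !inE eq_sym ei iK; apply.
    by rewrite !hi.
  have := cardsC [set j | tnth (u j) i]; rewrite card_ord.
  have -> : ~: [set j | tnth (u j) i] = [set j | ~~ tnth (u j) i].
    by apply/setP => j; rewrite !inE.
  lia.
have [w [Cw wv vw]] := H _ (supp v) (leqnn _) (subxx _).
suff -> : v = w by [].
apply: eq_from_tnth => i; apply/idP/idP; last exact: wv.
by have := subsetP vw i; rewrite !inE.
Qed.
End Complete.

(** * Maximal elements of the closure *)

Lemma covbS (V W : {set 'I_n}) : V \subset W -> covb S W -> covb S V.
Proof.
move=> VW /covbP h; apply/covbP => K K0 Kk KV.
by apply: h => //; apply: subset_trans VW.
Qed.

(** In a small set containing [j], replace [j] by [i], or just drop it if column [j] is constantly
    1: the size does not grow, and a member of [S] covering the new set also covers the old one. *)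
Lemma covbU1 (V : {set 'I_n}) j : covb S V ->
  (forall s, s \in S -> tnth s j) \/
    (exists2 i, i \in V & forall s, s \in S -> tnth s i -> tnth s j) ->
  (exists s, s \in S) -> covb S (j |: V).
Proof.
move=> /covbP cov hj [s0 s0S]; apply/covbP => K K0 Kk KV.
have KV' : K :\ j \subset V.
  apply/subsetP => l; rewrite !inE => /andP[lj /(subsetP KV)].
  by rewrite !inE (negPf lj).
have step s : s \in S -> (K :\ j \subset supp s) -> tnth s j ->
  exists2 s, s \in S & K \subset supp s.
  move=> sS Ks sj; exists s => //; apply/subsetP => l lK; rewrite inE.
  have [->//|lj] := eqVneq l j.
  by have := subsetP Ks l; rewrite !inE lj lK; apply.
have [jK|jK] := boolP (j \in K); last first.
  apply: cov => //; apply: subset_trans KV'; apply/subsetP => l lK; rewrite !inE lK andbT.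
  by apply: contraNneq jK => <-.
have cK : #|K| = (#|K :\ j|).+1 by rewrite (cardsD1 j) jK.
case: hj => [hj|[i iV hi]].
  have [Kj0|Kj0] := eqVneq (K :\ j) set0.
    by apply: (step s0 s0S); rewrite ?Kj0 ?sub0set ?hj.
  have [|s sS Ks] := cov _ Kj0 _ KV'; first by rewrite ltnW -?cK.
  by apply: (step s sS Ks); apply: hj.
have [|||s sS Ks] := cov (i |: K :\ j).
- by apply/set0Pn; exists i; rewrite !inE eqxx.
- by rewrite cardsU1; case: (_ \notin _); lia.
- by rewrite subUset sub1set iV.
apply: (step s sS); first by apply: subset_trans Ks; apply: subsetUr.
by apply: hi => //; have := subsetP Ks i; rewrite !inE eqxx; apply.
Qed.

(** By maximality [V] absorbs every column that [covbU1] allows to add, which yields both column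
    conditions of [Cl_complete]. *)
Lemma maxset_covb_Cl (V : {set 'I_n}) : (exists s, s \in S) -> maxset (covb S) V ->
  Cl (S12 k) S (charvec V).
Proof.
move=> Sn /maxsetP[cov max].
have add j : (forall s, s \in S -> tnth s j) \/
    (exists2 i, i \in V & forall s, s \in S -> tnth s i -> tnth s j) -> j \in V.
  move=> hj; rewrite -(max (j |: V)) ?setU11 ?subsetUr //; exact: covbU1.
apply: Cl_complete => //; last by rewrite charvecK.
- move=> i; rewrite tnth_mktuple => iV; apply/exists_inP; apply: contraR iV.
  rewrite negb_exists_in => /forall_inP h; apply: add; left => s /h.
  by rewrite negbK.
- move=> i j; rewrite !tnth_mktuple => iV jV; apply/exists_inP; apply: contraR iV.
  rewrite negb_exists_in => /forall_inP h; apply: add; right; exists j => // s /h.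
  by rewrite negbK => /eqP->.
Qed.

(** The vector of ones is outside the closure, so properness excludes only zero; every closure
    vector extends to a maximal [covb] set, which is again in the closure. *)
Lemma maximal_proper_covb v : ~~ covb S setT ->
  maximal_in (Cl_proper (S12 k) S) v <-> supp v != set0 /\ maxset (covb S) (supp v).
Proof.
move=> nT.
have ntT (V : {set 'I_n}) : covb S V -> V != setT by apply: contraTneq => ->.
split=> [[[Cv /supp_eq0 v0 _] max] | [v0 mv]].
  split=> //; have [V mV vV] := maxset_exists (Cl_covb Cv).
  have CV := maxset_covb_Cl (Cl_nonempty Cv) mV.
  suff <- : charvec V = v by rewrite charvecK.
  apply: max; last by apply/vec_leP; rewrite charvecK.
  split=> //; last by apply/supp_eqT; rewrite charvecK; apply: ntT; case/maxsetP: mV.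
  by apply/supp_eq0; rewrite charvecK; apply: contraNneq v0 => V0; rewrite -subset0 -V0.
have [cov max] := maxsetP mv.
have Sn : exists s, s \in S.
  have /set0Pn[i iv] := v0.
  have [||| s sS _] := covbP _ _ cov [set i]; last by exists s.
  - by apply/set0Pn; exists i; rewrite inE.
  - by rewrite cards1.
  - by rewrite sub1set.
have Cv := maxset_covb_Cl Sn mv; rewrite suppK in Cv.
split; first by split=> //; [apply/supp_eq0|apply/supp_eqT; apply: ntT].
move=> w [Cw _ _] /vec_leP vw; rewrite -(suppK w) -(suppK v).
by congr charvec; apply: max => //; apply: Cl_covb.
Qed.

Definition differ i : {set 'I_n} := [set j | [exists s in S, tnth s j != tnth s i]].

(** Every set is now covered, so only the column conditions restrict membership. The largest member
    omitting a column [i] that is not constantly 1 omits just the columns equal to it. *)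
Lemma maximal_proper_classes v : covb S setT ->
  maximal_in (Cl_proper (S12 k) S) v <->
  supp v != set0 /\ exists2 i, exists2 s, s \in S & ~~ tnth s i & supp v = differ i.
Proof.
move=> covT.
have Cd i : (exists2 s, s \in S & ~~ tnth s i) -> Cl (S12 k) S (charvec (differ i)).
  move=> [s sS si]; apply: Cl_complete.
  - move=> l; rewrite tnth_mktuple inE negb_exists_in => /forall_inP h.
    by exists s => //; have /negPn/eqP -> := h s sS.
  - move=> l j; rewrite !tnth_mktuple !inE negb_exists_in => /forall_inP h.
    case/exists_inP=> t tS tj; exists t => //; have /negPn/eqP -> := h t tS.
    by rewrite eq_sym.
  - by exists s.
  - by apply: covbS covT; apply: subsetT.
split=> [[[Cv /supp_eq0 v0 /supp_eqT vT] max] | [v0 [i ci Ev]]].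
  split=> //; have : ~~ [forall i, i \in supp v].
    by apply: contra vT => /forallP h; apply/eqP/setP => i; rewrite h inE.
  rewrite negb_forall => /existsP[i]; rewrite inE => vi.
  have ci : exists2 s, s \in S & ~~ tnth s i.
    apply/exists_inP; apply: contraR vi; rewrite negb_exists_in => /forall_inP h.
    by apply: (Cl_const Cv) => s /h; rewrite negbK.
  have vd : supp v \subset differ i.
    apply/subsetP => j; rewrite !inE => vj; apply: contraR vi.
    rewrite negb_exists_in => /forall_inP h; rewrite -(Cl_eq_columns Cv (i := j)) //.
    by move=> s /h; rewrite negbK => /eqP.
  exists i => //; rewrite -(max (charvec (differ i))) ?charvecK //; last first.
    by apply/vec_leP; rewrite charvecK.
  split; [exact: Cd|apply/supp_eq0|apply/supp_eqT]; rewrite charvecK.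
    by apply: contraNneq v0 => d0; rewrite -subset0 -d0.
  apply/negP => /eqP dT; have := in_setT i; rewrite -dT inE => /exists_inP[s _].
  by rewrite eqxx.
have iv : ~~ tnth v i.
  apply/negP => vi; have : i \in supp v by rewrite inE.
  by rewrite Ev inE => /exists_inP[s _]; rewrite eqxx.
split.
  split; [by rewrite -(suppK v) Ev; apply: Cd|exact/supp_eq0|apply/supp_eqT].
  by apply: contraNneq iv => vT; have := in_setT i; rewrite -vT inE.
move=> w [Cw _ /supp_eqT wT] /vec_leP vw; rewrite -(suppK w) -(suppK v); congr charvec.
apply/eqP; rewrite eqEsubset vw andbT Ev; apply/subsetP => j jw; rewrite inE.
apply: contraR wT; rewrite negb_exists_in => /forall_inP h.
have wi : tnth w i.
  have : tnth w j by rewrite inE in jw.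
  by rewrite (Cl_eq_columns Cw (j := i)) // => s /h; rewrite negbK => /eqP.
apply/eqP/setP => l; rewrite [RHS]inE.
have [lv|] := boolP (l \in supp v); first exact: (subsetP vw).
rewrite Ev !inE negb_exists_in => /forall_inP hl.
by rewrite (Cl_eq_columns Cw (j := i)) // => s /hl; rewrite negbK => /eqP.
Qed.
End Closure.

(** * Correctness of the reductions *)

Lemma subE d e s :
  sub d e s = all (fun i => ~~ violates d (nth false e i) (nth false s i)) (iota 0 (size e)).
Proof.
elim: e s => //= a e IH s; rewrite IH nth0; congr (_ && _).
by rewrite (iotaDl 1 0) all_map; apply: eq_all => i /=; rewrite nth_behead.
Qed.

Lemma mem_exts p e0 e :
  e \in exts p e0 <-> exists2 i, i < size e0 & e = rev p ++ set_nth false e0 i true.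
Proof.
elim: e0 p e => [|b e0 IH] p e /=; first by split=> // -[].
rewrite inE; split=> [/orP[/eqP->|/IH[i hi ->]]|[[|i] hi ->]].
- by exists 0.
- by exists i.+1; rewrite // rev_cons cat_rcons.
- by rewrite eqxx.
- by apply/orP; right; apply/IH; exists i; rewrite // rev_cons cat_rcons.
Qed.

Definition word_set N (e : seq bool) : {set 'I_N} := [set i : 'I_N | nth false e i].

Lemma word_setK N e : size e = N -> val (charvec (word_set N e)) = e.
Proof.
move=> sE; apply: (@eq_from_nth _ false); rewrite size_tuple // => i hi.
by rewrite (nth_mktuple _ _ (Ordinal hi)) inE.
Qed.

Lemma charvec_inj N : injective (@charvec N).
Proof. exact: can_inj (@charvecK N). Qed.

Lemma nth_charvec N (E : {set 'I_N}) (i : 'I_N) : nth false (charvec E) i = (i \in E).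
Proof. by rewrite nth_mktuple. Qed.

Lemma set_nth_charvec N (E : {set 'I_N}) (i : 'I_N) :
  set_nth false (charvec E) i true = val (charvec (i |: E)).
Proof.
have sz : size (set_nth false (charvec E) i true) = N.
  by rewrite size_set_nth size_tuple; apply/maxn_idPr.
apply: (@eq_from_nth _ false); rewrite sz ?size_tuple // => j hj.
rewrite nth_set_nth /= -[j]/(val (Ordinal hj)) !nth_charvec !inE.
by rewrite -val_eqE /=; case: eqP.
Qed.

Lemma mem_tuples_seq k N (E : {set 'I_N}) :
  val (charvec E) \in tuples k N <-> exists2 t : seq 'I_N, size t = k & E = [set x in t].
Proof.
elim: k E => [|k IH] E.
  rewrite inE; split=> [/eqP E0|[[|//] _ ->]].
    exists [::] => //; apply/setP => i; rewrite !inE -nth_charvec E0.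
    by rewrite nth_nseq if_same.
  apply/eqP/(@eq_from_nth _ false); rewrite size_tuple ?size_nseq // => i hi.
  by rewrite -[i in LHS]/(val (Ordinal hi)) nth_charvec inE nth_nseq if_same.
rewrite /tuples iterS -/(tuples k N); split.
  case/flatten_mapP=> e0 He0 /mem_exts[i hi Ee].
  change (val (charvec E) = set_nth false e0 i true) in Ee.
  have s0 : size e0 = N by apply/eqP/(allP (all_size_tuples k N)).
  rewrite s0 in hi; rewrite -(word_setK s0) in He0 Ee.
  have [t st Et] := (IH _).1 He0.
  exists (Ordinal hi :: t); first by rewrite /= st.
  rewrite -[i]/(val (Ordinal hi)) set_nth_charvec in Ee.
  rewrite (charvec_inj (val_inj Ee)).
  by rewrite Et set_cons.
case=> [[|i t]] // [st] ->; apply/flatten_mapP.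
exists (val (charvec [set x in t])); first by apply/IH; exists t.
by apply/mem_exts; exists i; rewrite ?size_tuple //= set_nth_charvec -set_cons.
Qed.

Lemma mem_tuples k N (E : {set 'I_N}) : 0 < k ->
  (val (charvec E) \in tuples k N) = (E != set0) && (#|E| <= k).
Proof.
move=> k0; apply/idP/idP => [/mem_tuples_seq[t st ->]|/andP[/set0Pn[x xE] Ek]].
  apply/andP; split; last by rewrite -st cardsE card_size.
  case: t st => [|x t] st; first by rewrite -st in k0.
  by apply/set0Pn; exists x; rewrite !inE eqxx.
(* A smaller set is reached by repeating one of its elements up to length [k]. *)
apply/mem_tuples_seq; exists (enum E ++ nseq (k - #|E|) x).
  by rewrite size_cat size_nseq -cardE subnKC.
apply/setP => y; rewrite inE mem_cat mem_enum mem_nseq.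
by case: (boolP (y \in E)) => //= yE; rewrite andbC; case: eqP yE => // ->; rewrite xE.
Qed.

Lemma encodeE n (s : seq (n.-tuple bool)) : encode s = enc n (map val s).
Proof. by rewrite /encode /enc /flat -map_comp. Qed.

Lemma all_size_map_val n (s : seq (n.-tuple bool)) : all (fun r => size r == n) (map val s).
Proof. by apply/allP => _ /mapP[v _ ->]; rewrite size_tuple. Qed.

(** The [sols] predicates quantify over all presentations of an instance, so unique decoding is what
    lets them be read off a given one. *)
Lemma encode_width n n' (s : seq (n.-tuple bool)) (s' : seq (n'.-tuple bool)) :
  encode s = encode s' -> n = n'.
Proof.
rewrite !encodeE => E; rewrite -(width_enc n (map val s) [::]).
by rewrite E width_enc.
Qed.

Lemma encode_inj n : injective (@encode n).
Proof.
move=> s s'; rewrite !encodeE => E; apply: (inj_map val_inj).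
by rewrite -(rows_enc n (map val s) [::]) E rows_enc.
Qed.

Lemma sols_EnumClosureMax F n (s : seq (n.-tuple bool)) u :
  sols (EnumClosureMax F) (encode s) u <->
  exists2 v, maximal_in (Cl_proper F [set:: s]) v & u = bits v.
Proof.
split=> [[n' [s' [v [E M ->]]]]|[v M ->]]; last by exists n, s, v.
have En := encode_width E; subst n'; rewrite (encode_inj E); by exists v.
Qed.

Lemma sols_EnumKMaxIndSet k n (s : seq {set 'I_n}) u :
  sols (EnumKMaxIndSet k) (encode (map (@charvec n) s)) u <->
  exists2 I, maxset (independent [set:: s]) I & u = bits (charvec I).
Proof.
split=> [[n' [s' [I [E M ->]]]]|[I M ->]]; last by exists n, s, I.
have En := encode_width E; subst n'.
by rewrite (inj_map (@charvec_inj n) (encode_inj E)); exists I.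
Qed.

Definition reduced_sets a k d n L : seq {set 'I_(n + a)} :=
  [seq word_set (n + a) e | e <- filter (accept d L) (tuples k (n + a))].

Lemma reductionE a k d n L :
  reduction a k d n L = encode (map (@charvec _) (reduced_sets a k d n L)).
Proof.
rewrite encodeE /reduction /reduced_sets -!map_comp; congr enc.
rewrite -[LHS]map_id; apply/eq_in_map => e; rewrite mem_filter => /andP[_ He].
by apply/esym/word_setK/eqP/(allP (all_size_tuples k _)).
Qed.

Lemma mem_reduced_sets a k d n L (E : {set 'I_(n + a)}) : 0 < k ->
  (E \in reduced_sets a k d n L) =
  [&& E != set0, #|E| <= k & accept d L (charvec E)].
Proof.
move=> k0; apply/mapP/idP => [[e]|].
  rewrite mem_filter => /andP[ae Te] ->.
  have se : size e = n + a by apply/eqP/(allP (all_size_tuples k _)).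
  by rewrite -{1}(word_setK se) mem_tuples // in Te; rewrite word_setK // andbA Te.
rewrite andbA -mem_tuples // => /andP[TE aE].
exists (val (charvec E)); first by rewrite mem_filter aE.
by apply/setP => i; rewrite inE nth_charvec.
Qed.

Lemma enc_cat_inj n n' L L' y y' : enc n L ++ bits y = enc n' L' ++ bits y' ->
  [/\ n = n', L = L' & y = y'].
Proof.
move=> E; have := splitw_enc n L y; rewrite E splitw_enc => -[En /rcons_inj[-> ->]].
by split=> //; have := congr1 size En; rewrite !size_nseq.
Qed.

(** Every [P]-set [V] lies in [up (down V)], again a [P]-set, so a maximal one is fixed by [up]
    after [down]. Both reductions use this, [up] being an embedding of the original columns. *)
Lemma maxset_transport (A B : finType) (P : pred {set A}) (Q : pred {set B})
    (up : {set B} -> {set A}) (down : {set A} -> {set B}) :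
  {homo up : I J / I \subset J} -> {homo down : V W / V \subset W} -> cancel up down ->
  (forall I, Q I -> P (up I)) -> (forall V, P V -> Q (down V)) ->
  (forall V, P V -> V \subset up (down V)) ->
  forall W, maxset P W <-> exists2 I, maxset Q I & W = up I.
Proof.
move=> upS downS upK QP PQ Pud W; split=> [/maxsetP[PW maxW]|[I /maxsetP[QI maxI] ->]].
  have EW : up (down W) = W by apply: maxW; [exact/QP/PQ|exact: Pud].
  exists (down W) => //; apply/maxsetP; split; first exact: PQ.
  move=> J QJ WJ; rewrite -[LHS]upK; congr down; apply: maxW; first exact: QP.
  by rewrite -EW; apply: upS.
apply/maxsetP; split=> [|V PV IV]; first exact: QP.
apply/eqP; rewrite eqEsubset IV andbT.
suff <- : down V = I by apply: Pud.
by apply: maxI; [exact: PQ|rewrite -(upK I); apply: downS].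
Qed.

Lemma preimset_lshiftK n a : cancel (fun V : {set 'I_n} => lshift a @: V)
  (fun W : {set 'I_(n + a)} => lshift a @^-1: W).
Proof.
by move=> V; apply/setP => i; rewrite inE mem_imset //; apply: lshift_inj.
Qed.

Lemma charvec_cat n a (W : {set 'I_(n + a)}) :
  exists2 z, size z = a & val (charvec W) = charvec (lshift a @^-1: W) ++ z.
Proof.
exists (drop n (charvec W)); first by rewrite size_drop size_tuple addKn.
rewrite -[LHS](cat_take_drop n); congr cat.
have st : size (take n (charvec W)) = n by rewrite size_take size_tuple; case: ltnP; lia.
apply: (@eq_from_nth _ false); rewrite st ?size_tuple // => i hi.
rewrite nth_take // (nth_charvec W (lshift a (Ordinal hi))).
by rewrite (nth_charvec _ (Ordinal hi)) inE.
Qed.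

(** At the [a] new columns the padding of [t] is read, that is 0. *)
Lemma sub_charvecT n a (E : {set 'I_(n + a)}) (t : n.-tuple bool) :
  sub true (charvec E) t =
  (E \subset lshift a @: supp t).
Proof.
rewrite subE size_tuple; apply/allP/subsetP => [h i iE|h i].
  have := h i; rewrite mem_iota nth_charvec iE /= negbK => /(_ (ltn_ord i)).
  rewrite -(splitK i); case: splitP => [j _|j _] /=.
    by move=> tj; apply/imsetP; exists j; rewrite // inE (tnth_nth false).
  by rewrite nth_default // size_tuple leq_addr.
rewrite mem_iota add0n => /andP[_ hi].
rewrite -[i]/(val (Ordinal hi)) nth_charvec /violates; apply/negP => /andP[/h].
by case/imsetP=> j; rewrite inE (tnth_nth false) => tj -> /=; rewrite tj.
Qed.

Lemma sub_charvecF n a (E : {set 'I_(n + a)}) (h : {set 'I_n}) :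
  sub false (charvec E) (charvec h) = (lshift a @: h \subset E).
Proof.
rewrite subE size_tuple; apply/allP/subsetP => [H _ /imsetP[j jh ->]|H i].
  have := H (lshift a j); rewrite mem_iota nth_charvec /= nth_charvec jh /= negbK.
  by apply; rewrite add0n; apply: leq_trans (ltn_ord j) (leq_addr _ _).
rewrite mem_iota add0n => /andP[_ hi]; rewrite -[i]/(val (Ordinal hi)) nth_charvec /violates.
apply/negP => /andP[]; have [hn|hn] := ltnP i n.
  rewrite -[val _]/(val (Ordinal hn)) nth_charvec => ih /negP; apply.
  have -> : Ordinal hi = lshift a (Ordinal hn) by apply: val_inj.
  by apply: H; apply: imset_f.
by rewrite nth_default // size_tuple.
Qed.

Lemma in_setseq (T : finType) (s : seq T) x : (x \in [set:: s]) = (x \in s).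
Proof. by rewrite inE. Qed.

(** * From independent sets to closures *)

Section IndSetToClosure.
Variables (k n : nat) (s : seq {set 'I_n}).
Hypotheses (k_gt0 : 0 < k) (dim_s : dimension [set:: s] = k).

Let L := map val (map (@charvec n) s).
Let S : {set (n + 1).-tuple bool} := [set:: map (@charvec _) (reduced_sets 1 k false n L)].

Lemma mem_S v : v \in S -> [/\ supp v != set0, #|supp v| <= k
  & forall h, h \in s -> ~~ (lshift 1 @: h \subset supp v)].
Proof.
rewrite in_setseq => /mapP[E]; rewrite mem_reduced_sets // => /and3P[E0 Ek aE] ->.
rewrite charvecK; split=> // h hs; apply: contra aE => hE; apply/hasP.
exists (val (charvec h)); last by rewrite sub_charvecF.
by rewrite /L -map_comp; apply/mapP; exists h.
Qed.

Lemma charvec_mem_S E : E != set0 -> #|E| <= k ->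
  (forall h, h \in s -> ~~ (lshift 1 @: h \subset E)) -> charvec E \in S.
Proof.
move=> E0 Ek hE; rewrite in_setseq; apply/map_f; rewrite mem_reduced_sets // E0 Ek /=.
apply/hasP => -[_ /mapP[_ /mapP[h hs ->] ->]]; rewrite sub_charvecF.
exact/negP/hE.
Qed.

Lemma card_edge h : h \in s -> #|h| <= k.
Proof. by move=> hs; rewrite -dim_s; apply: (leq_bigmax_cond h); rewrite in_setseq. Qed.

Lemma card_lshift a (h : {set 'I_n}) : #|lshift a @: h| = #|h|.
Proof. by rewrite card_imset //; apply: lshift_inj. Qed.

(** An edge has at most [k] elements, so inside [V] it would be covered by a member of [S], which
    contains no edge. For an empty edge, a point of [V] provides the contradictory member. *)
Lemma covb_S_avoids (V : {set 'I_(n + 1)}) h :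
  covb k S V -> V != set0 -> h \in s -> ~~ (lshift 1 @: h \subset V).
Proof.
move=> /covbP cov V0 hs; apply/negP => hV.
have [h0|h0] := eqVneq h set0.
  have /set0Pn[i iV] := V0.
  have [|||t /mem_S[_ _ /(_ h hs)]] := cov [set i].
  - by apply/set0Pn; exists i; rewrite inE.
  - by rewrite cards1.
  - by rewrite sub1set.
  by rewrite h0 imset0 sub0set.
have [|||t /mem_S[_ _ /(_ h hs) /negP]] := cov (lshift 1 @: h) => //.
  by rewrite -card_gt0 card_lshift card_gt0.
by rewrite card_lshift card_edge.
Qed.

Lemma covb_S (V : {set 'I_(n + 1)}) : (forall h, h \in s -> ~~ (lshift 1 @: h \subset V)) -> covb k S V.
Proof.
move=> hV; apply/covbP => K K0 Kk KV; exists (charvec K); last by rewrite charvecK.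
apply: charvec_mem_S => // h /hV; apply: contra => hK; exact: subset_trans KV.
Qed.

(** As the dimension [k] is positive, there is an edge, and the full set contains it. *)
Lemma not_covb_S : ~~ covb k S setT.
Proof.
apply/negP => cov.
have [h hs hk] : exists2 h, h \in s & #|h| = k.
  have : 0 < #|[set:: s]|.
    rewrite card_gt0; apply: contraTneq k_gt0 => s0.
    by rewrite -dim_s /dimension s0 big_set0.
  case/(eq_bigmax_cond (fun e : {set 'I_n} => #|e|)) => h hs Eh; exists h.
    by rewrite -in_setseq.
  by rewrite -Eh.
apply: (negP (covb_S_avoids cov _ hs)); last exact: subsetT.
by apply/set0Pn; exists (rshift n ord0); rewrite inE.
Qed.

Let up (I : {set 'I_n}) : {set 'I_(n + 1)} := rshift n ord0 |: lshift 1 @: I.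

Lemma up_preimset : cancel up (fun W => lshift 1 @^-1: W).
Proof.
move=> I; apply/setP => i; rewrite !inE eq_lrshift /= mem_imset //.
exact: lshift_inj.
Qed.

Lemma maxset_covb_S W : W != set0 /\ maxset (covb k S) W <->
  exists2 I, maxset (independent [set:: s]) I & W = up I.
Proof.
have indepP I : reflect (forall h, h \in s -> ~~ (lshift 1 @: h \subset up I))
    (independent [set:: s] I).
  apply: (iffP forall_inP) => H h hs.
    have hS : h \in [set:: s] by rewrite in_setseq.
    apply: contra (H h hS) => hI; apply/subsetP => i ih; have := subsetP hI (lshift 1 i).
    rewrite (imset_f _ ih) !inE eq_lrshift /= mem_imset; first exact.
    exact: lshift_inj.
  rewrite in_setseq in hs; apply: contra (H h hs) => hI.
  by apply: subset_trans (imsetS _ hI) (subsetUr _ _).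
have up0 I : up I != set0 by apply/set0Pn; exists (rshift n ord0); rewrite !inE eqxx.
(* The empty set is always [covb], but not independent when it is an edge; hence the transport
   concerns nonempty sets. *)
have T := @maxset_transport _ _ (fun W => (W != set0) && covb k S W)
  (independent [set:: s]) up (fun W => lshift 1 @^-1: W).
have upd (V : {set 'I_(n + 1)}) : V \subset up (lshift 1 @^-1: V).
  apply/subsetP => i iV; rewrite -(splitK i); case: splitP => j Ej /=.
    rewrite inE orbC mem_imset ?inE; last exact: lshift_inj.
    suff -> : lshift 1 j = i by rewrite iV.
    by apply: val_inj; rewrite /= Ej.
  by rewrite (ord1 j) !inE eqxx.
have {}T : forall W, maxset (fun W => (W != set0) && covb k S W) W <->
    exists2 I, maxset (independent [set:: s]) I & W = up I.
  apply: T.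
  - by move=> I J IJ; apply: setUS; apply: imsetS.
  - by move=> V V' VV; apply: preimsetS.
  - exact: up_preimset.
  - by move=> I /indepP iI; rewrite up0; apply: covb_S.
  - move=> V /andP[V0 cV]; apply/forall_inP => h; rewrite in_setseq => hs.
    apply: contra (covb_S_avoids cV V0 hs) => hV.
    by apply/subsetP => _ /imsetP[i ih ->]; have := subsetP hV _ ih; rewrite inE.
  - by move=> V _; apply: upd.
rewrite -T; split=> [[W0 /maxsetP[cW mW]]|/maxsetP[/andP[W0 cW] mW]].
  by apply/maxsetP; rewrite W0 cW; split=> // V /andP[_ cV]; apply: mW.
split=> //; apply/maxsetP; split=> // V cV WV; apply: mW => //.
by rewrite cV andbT; apply: contraNneq W0 => V0; rewrite -subset0 -V0.
Qed.

Lemma sols_reduction_IndSet y :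
  sols (EnumClosureMax (S12 k)) (reduction 1 k false n L) y <->
  exists2 I, maxset (independent [set:: s]) I & y = bits (charvec (up I)).
Proof.
rewrite reductionE sols_EnumClosureMax; split=> [[v]|[I mI ->]].
  rewrite maximal_proper_covb //; last exact: not_covb_S.
  case/maxset_covb_S=> I mI EI ->; exists I => //; by rewrite -EI suppK.
exists (charvec (up I)) => //; rewrite maximal_proper_covb //; last exact: not_covb_S.
by rewrite charvecK; apply/maxset_covb_S; exists I.
Qed.

Lemma charvec_up I : exists b, val (charvec (up I)) = charvec I ++ [:: b].
Proof.
have [z] := charvec_cat (up I); rewrite up_preimset.
by case: z => [|b [|]] // _ ->; exists b.
Qed.
End IndSetToClosure.

(** The problem [C] of this reduction: its one solution is [y] without the coordinate of the added
    vertex. *)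
Definition truncated : enum_problem := {|
  inst w := exists n L v b, w = enc n L ++ bits (v ++ [:: b]) /\ size v = n;
  sols w u := exists n L v b, [/\ w = enc n L ++ bits (v ++ [:: b]), size v = n & u = bits v]
|}.

Lemma sols_truncated n L v b u : size v = n ->
  sols truncated (enc n L ++ bits (v ++ [:: b])) u <-> u = bits v.
Proof.
move=> sv; split=> [[n' [L' [v' [b' [/enc_cat_inj[_ _ E] _ ->]]]]]|->].
  by move: E; rewrite !cats1 => /rcons_inj[->].
by exists n, L, v, b.
Qed.

Lemma poly_delay_truncated : poly_delay truncated.
Proof.
apply: (@poly_delay_run _ (take_word 1) 100 2) => x [n [L [v [b [-> sv]]]]].
have R := @run_take_word n L v [:: b].
set x0 := enc n L ++ bits (v ++ [:: b]) in R *.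
exists [:: v], (enc n L); split=> //.
- by apply: run_le R _; rewrite expnS expn1; nia.
- rewrite expnS expn1 /flat /= cats0 size_rcons size_map.
  by rewrite /x0 size_cat size_map size_cat /=; nia.
- by move=> y; rewrite inE sols_truncated //; split=> [/eqP|->].
Qed.

Lemma IndSet_reduces_to_Closure k : 0 < k ->
  pd_reduces (EnumKMaxIndSet k) (EnumClosureMax (S12 k)).
Proof.
move=> k0; exists (fun x => reduction 1 k false (width x) (rows x)), truncated; split.
- have [c [p H]] := polytime_reduction 1 k false.
  exists c, p => x [n [s [-> _]]]; apply: H.
  by exists n; eexists; split; [exact: encodeE|exact: all_size_map_val].
- exact: poly_delay_truncated.
move=> _ [n [s [-> dim_s]]].
have Er : reduction 1 k false (width (encode (map (@charvec n) s)))
    (rows (encode (map (@charvec n) s)))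
  = reduction 1 k false n (map val (map (@charvec n) s)).
  rewrite encodeE; congr reduction.
    by rewrite -[enc _ _]cats0 (width_enc _ _ [::]).
  by rewrite -[enc _ _]cats0 (rows_enc _ _ [::]).
rewrite Er; split.
- by rewrite reductionE; do 2 eexists.
- move=> y /sols_reduction_IndSet[] // I _ ->; have [b ->] := charvec_up I.
  by rewrite encodeE; do 4 eexists; split; [reflexivity|rewrite size_tuple].
- move=> y z /sols_reduction_IndSet[] // I _ -> /sols_reduction_IndSet[] // J _ -> yz u.
  have [b EI] := charvec_up I; have [c EJ] := charvec_up J.
  rewrite encodeE EI EJ !sols_truncated ?size_tuple // => -[-> E].
  (* The added vertex is always present, so dropping its bit loses nothing. *)
  apply: yz; suff -> : I = J by [].
  by apply/charvec_inj/val_inj/(inj_map (f := Some)) => // ? ? [].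
- move=> u; rewrite sols_EnumKMaxIndSet; split=> [[I mI ->]|[y [] /sols_reduction_IndSet[] // I mI ->]].
    exists (bits (charvec (rshift n ord0 |: lshift 1 @: I))); split.
      by apply/sols_reduction_IndSet => //; exists I.
    have [b ->] := charvec_up I.
    by rewrite encodeE sols_truncated // size_tuple.
  have [b ->] := charvec_up I.
  by rewrite encodeE sols_truncated ?size_tuple // => ->; exists I.
Qed.

(** * From closures to independent sets *)

Section ClosureToIndSet.
Variables (k n : nat) (s : seq (n.-tuple bool)).
Hypothesis k_gt0 : 0 < k.

Let L := map val s.
Let R := reduced_sets k k true n L.

Lemma mem_edges E : (E \in R) = [&& E != set0, #|E| <= k
  & ~~ has (fun t => E \subset lshift k @: supp t) s].
Proof.
rewrite mem_reduced_sets // /accept /L has_map; congr [&& _, _ & ~~ _].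
by apply: eq_has => t /=; rewrite -sub_charvecT.
Qed.

(** The [k] zero columns together form an uncovered set of exactly [k] elements. *)
Lemma dimension_edges : dimension [set:: R] = k.
Proof.
apply/eqP; rewrite eqn_leq; apply/andP; split.
  by apply/bigmax_leqP => E; rewrite in_setseq mem_edges => /and3P[].
pose E := @rshift n k @: setT.
have cE : #|E| = k by rewrite card_imset ?cardsT ?card_ord //; apply: rshift_inj.
rewrite -[X in X <= _]cE; apply: (leq_bigmax_cond E); rewrite in_setseq mem_edges cE leqnn.
have i0 : rshift n (Ordinal k_gt0) \in E by apply: imset_f.
apply/and3P; split=> //; first by apply/set0Pn; exists (rshift n (Ordinal k_gt0)).
apply/hasPn => t _; apply/negP => /subsetP/(_ _ i0)/imsetP[j _ /eqP].
by rewrite eq_rlshift.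
Qed.

Let independentP (W : {set 'I_(n + k)}) : reflect (forall E : {set 'I_(n + k)}, E != set0 -> #|E| <= k -> E \subset W ->
    exists2 t, t \in s & E \subset lshift k @: supp t)
  (independent [set:: R] W).
Proof.
apply: (iffP forall_inP) => H E => [E0 Ek EW|].
  apply/hasP; apply: contraT => nE; have : E \in [set:: R].
    by rewrite in_setseq mem_edges E0 Ek.
  by move/H; rewrite EW.
rewrite in_setseq mem_edges => /and3P[E0 Ek /hasP nE]; apply/negP => EW.
by apply: nE; have [t ts Et] := H E E0 Ek EW; exists t.
Qed.

Lemma maxset_edges W : maxset (independent [set:: R]) W <->
  exists2 V, maxset (covb k [set:: s]) V & W = lshift k @: V.
Proof.
have lshK := @preimset_lshiftK n k.
apply: (@maxset_transport _ _ _ _ (fun V : {set 'I_n} => lshift k @: V)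
  (fun W : {set 'I_(n + k)} => lshift k @^-1: W)) => {W}.
- by move=> I J; apply: imsetS.
- by move=> I J; apply: preimsetS.
- exact: lshK.
- move=> V /covbP cV; apply/independentP => E E0 Ek EV.
  have EE : E = lshift k @: (lshift k @^-1: E).
    apply/setP => i; apply/idP/imsetP => [iE|[j]]; last by rewrite inE => jE ->.
    by have /imsetP[j jV Ei] := subsetP EV _ iE; exists j; rewrite // inE -Ei.
  rewrite EE in E0 Ek EV *; move: (lshift k @^-1: E) E0 Ek EV => K K0 Kk KV.
  have [|||t ts Kt] := cV K.
  + by apply: contraNneq K0 => ->; rewrite imset0.
  + by rewrite -(card_lshift k).
  + by rewrite -(lshK K) -(lshK V); apply: preimsetS.
  by exists t; [rewrite in_setseq in ts|apply: imsetS].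
- move=> W /independentP iW; apply/covbP => K K0 Kk KW.
  have [|||t ts Et] := iW (lshift k @: K).
  + by rewrite -card_gt0 card_lshift card_gt0.
  + by rewrite card_lshift.
  + by apply/subsetP => _ /imsetP[i iK ->]; have := subsetP KW i iK; rewrite inE.
  by exists t; rewrite ?in_setseq // -(lshK K) -(lshK (supp t)); apply: preimsetS.
(* A single zero column is already an edge, so an independent set uses original columns only. *)
- move=> W /independentP iW; apply/subsetP => i iW'.
  have [|||t _ ] := iW [set i]; rewrite ?cards1 ?sub1set //.
    by apply/set0Pn; exists i; rewrite inE.
  case/imsetP=> j _ Ei; rewrite Ei; apply: imset_f; by rewrite inE -Ei.
Qed.

Lemma sols_reduction_Closure y :
  sols (EnumKMaxIndSet k) (reduction k k true n L) y <->
  exists2 V, maxset (covb k [set:: s]) V & y = bits (charvec (lshift k @: V)).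
Proof.
rewrite reductionE sols_EnumKMaxIndSet; split=> [[W /maxset_edges[V mV ->] ->]|[V mV ->]].
  by exists V.
by exists (lshift k @: V) => //; apply/maxset_edges; exists V.
Qed.

Lemma nth_columns i j L' r : all (fun t => size t == size r) L' -> j < size r ->
  nth false (columns i L' r) j = nth false r j || has (fun t => nth false t j != nth false t i) L'.
Proof.
have nth_mark b : forall t q j', size t = size q -> j' < size q ->
    nth false (mark b t q) j' = nth false q j' || (nth false t j' != b).
  elim=> [|c t IH] [|p q] [|j'] //= [E] hj; last exact: IH.
  by case: eqP; rewrite ?orbF ?orbT.
elim: L' r => [|t L' IH] r /=; first by rewrite orbF.
case/andP=> /eqP st hL hj; rewrite IH ?size_mark // nth_mark //.
by rewrite orbA.
Qed.

Lemma coclassE (i : 'I_n) : coclass n L i = charvec (differ [set:: s] i).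
Proof.
have hL : all (fun t => size t == size (nseq n false)) L.
  by rewrite size_nseq; apply: all_size_map_val.
have sz : size (coclass n L i) = n by rewrite size_columns // size_nseq.
apply: (@eq_from_nth _ false); rewrite sz ?size_tuple // => j hj.
rewrite /coclass (nth_columns _ hL) ?size_nseq // nth_nseq hj /=.
rewrite (nth_charvec _ (Ordinal hj)) inE has_map.
apply/hasP/exists_inP => -[t ts H]; exists t; rewrite ?in_setseq // in ts *.
  by rewrite !(tnth_nth false).
by rewrite !(tnth_nth false) in H.
Qed.

Lemma selectedE (i : 'I_n) : selected n L i =
  [exists t in [set:: s], ~~ tnth t i] && [forall j : 'I_n, (j < i) ==> (j \in differ [set:: s] i)].
Proof.
rewrite /selected coclassE has_map; congr (_ && _).
  apply/hasP/exists_inP => -[t ts H]; exists t; rewrite ?in_setseq // in ts *.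
    by rewrite (tnth_nth false).
  by rewrite /= -(tnth_nth false).
apply/allP/forallP => [H j|H b].
  apply/implyP => ji; rewrite -nth_charvec -(nth_take false ji).
  by apply: H; rewrite mem_nth // size_take size_tuple ltn_ord.
case/(nthP false) => j; rewrite size_take size_tuple ltn_ord => ji <-.
have jn := ltn_trans ji (ltn_ord i).
by rewrite nth_take // (nth_charvec _ (Ordinal jn)); have /implyP := H (Ordinal jn); apply.
Qed.

Lemma differ_refl (i : 'I_n) : i \notin differ [set:: s] i.
Proof. by rewrite inE; apply/exists_inP => -[t _]; rewrite eqxx. Qed.

Lemma has_charvec (V : {set 'I_n}) : has id (charvec V) = (V != set0).
Proof.
apply/hasP/set0Pn => [[b /(nthP false)[i + <-]]|[i iV]].
  by rewrite size_tuple => hi; rewrite (nth_charvec _ (Ordinal hi)) => iV; exists (Ordinal hi).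
by exists true => //; rewrite -iV -nth_charvec mem_nth // size_tuple.
Qed.

Lemma all_charvec (V : {set 'I_n}) : all id (charvec V) = (V == setT).
Proof.
apply/allP/eqP => [H|-> b /(nthP false)[i + <-]].
  by apply/setP => i; rewrite -nth_charvec inE; apply: H; rewrite mem_nth // size_tuple.
by rewrite size_tuple => hi; rewrite (nth_charvec _ (Ordinal hi)) inE.
Qed.

(** If the full set is [covb], it is the only maximal set and all answers are read from it;
    otherwise each nonempty maximal set gives itself. *)
Lemma maximal_solutions u :
  (exists2 v, maximal_in (Cl_proper (S12 k) [set:: s]) v & u = bits v) <->
  exists2 V, maxset (covb k [set:: s]) V & u \in map bits (solutions n L (charvec V)).
Proof.
have [cT|nT] := boolP (covb k [set:: s] setT); last first.
  have sol V : maxset (covb k [set:: s]) V ->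
      solutions n L (charvec V) = if V == set0 then [::] else [:: val (charvec V)].
    case/maxsetP=> cV _; rewrite /solutions all_charvec.
    have -> : (V == setT) = false by apply: contraNF nT => /eqP <-.
    by rewrite [filter _ _]/= has_charvec if_neg.
  split=> [[v + ->]|[V mV]].
    rewrite maximal_proper_covb // => -[v0 mv]; exists (supp v) => //.
    by rewrite sol // (negPf v0) suppK inE.
  rewrite sol //; case: eqP => // /eqP V0; rewrite inE => /eqP->.
  by exists (charvec V) => //; rewrite maximal_proper_covb // charvecK.
have mT V : maxset (covb k [set:: s]) V <-> V = setT.
  split=> [/maxsetP[_ mV]|->]; first by rewrite -(mV setT) ?subsetT.
  by apply/maxsetP; split=> // W _; rewrite subTset => /eqP.
have solT : solutions n L (charvec [set: 'I_n]) =
    filter (has id) [seq coclass n L i | i <- iota 0 n & selected n L i].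
  by rewrite /solutions all_charvec eqxx.
split=> [[v + ->]|[V /mT->]].
  rewrite maximal_proper_classes // => -[v0 [i [t ts ti] Ev]].
  exists setT; first exact/mT; rewrite solT.
  (* The first column of the class of [i] is the one that [selected] retains. *)
  case: (@arg_minnP _ i (fun j => j \notin differ [set:: s] i) val (differ_refl i)) => j jd jmin.
  have Ecol t' : t' \in [set:: s] -> tnth t' j = tnth t' i.
    move=> t's; apply/eqP; move: jd; rewrite inE negb_exists_in => /forall_inP/(_ t' t's).
    by rewrite negbK.
  have Ed : differ [set:: s] j = differ [set:: s] i.
    apply/setP => l; rewrite !inE; apply/exists_inP/exists_inP => -[t' t's];
    by [rewrite Ecol // => ?; exists t'|rewrite -Ecol // => ?; exists t'].
  have -> : v = charvec (differ [set:: s] j) by rewrite Ed -Ev suppK.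
  apply: map_f; rewrite mem_filter has_charvec Ed -Ev v0 Ev -Ed -coclassE; apply: map_f.
  rewrite mem_filter mem_iota leq0n add0n ltn_ord !andbT selectedE; apply/andP; split.
    by apply/exists_inP; exists t; rewrite ?Ecol.
  apply/forallP => l; apply/implyP => lj; rewrite Ed; apply: contraLR lj => ld.
  by rewrite -leqNgt; apply: jmin.
rewrite solT => /mapP[w]; rewrite mem_filter => /andP[w0 /mapP[i]].
rewrite mem_filter mem_iota => /andP[+ /andP[_ hi]].
rewrite -[i]/(val (Ordinal hi)) selectedE => /andP[/exists_inP ci _] Ew ->.
rewrite coclassE in Ew; exists (charvec (differ [set:: s] (Ordinal hi))); last by rewrite Ew.
rewrite maximal_proper_classes // charvecK -has_charvec -Ew; split=> //.
by exists (Ordinal hi).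
Qed.

(** A selected index is the least one outside its coclass, so the coclass determines it. *)
Lemma uniq_solutions v : uniq (solutions n L v).
Proof.
rewrite /solutions filter_uniq //; case: ifP => // _.
rewrite map_inj_in_uniq ?filter_uniq ?iota_uniq // => i j.
rewrite !mem_filter !mem_iota !add0n => /andP[si /andP[_ hi]] /andP[sj /andP[_ hj]].
rewrite -[i]/(val (Ordinal hi)) -[j]/(val (Ordinal hj)) in si sj *.
rewrite selectedE in si; rewrite selectedE in sj.
case/andP: si => _ /forallP si; case/andP: sj => _ /forallP sj.
rewrite !coclassE => E; have Ed := charvec_inj (val_inj E).
case: (ltngtP (val (Ordinal hi)) (val (Ordinal hj))) => // lt.
- have := implyP (sj _) lt; by rewrite -Ed (negPf (differ_refl _)).
- have := implyP (si _) lt; by rewrite Ed (negPf (differ_refl _)).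
Qed.
End ClosureToIndSet.

(** The problem [C] of this reduction: [z] holds the bits of the zero columns and is discarded. *)
Definition expanded k : enum_problem := {|
  inst w := exists n (s : seq (n.-tuple bool)) v z,
    [/\ w = encode s ++ bits (v ++ z), size v = n & size z = k];
  sols w u := exists n (s : seq (n.-tuple bool)) v z,
    [/\ w = encode s ++ bits (v ++ z), size v = n, size z = k
      & u \in map bits (solutions n (map val s) v)]
|}.

Lemma sols_expanded k n (s : seq (n.-tuple bool)) v z u : size v = n -> size z = k ->
  sols (expanded k) (encode s ++ bits (v ++ z)) u <->
  u \in map bits (solutions n (map val s) v).
Proof.
move=> sv sz; split=> [[n' [s' [v' [z' [E sv' sz' H]]]]]|H]; last by exists n, s, v, z.
move: E; rewrite !encodeE => /enc_cat_inj[En -> Ey]; move: H; rewrite En.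
suff -> : v = v' by [].
by move/(congr1 (take n)): Ey; rewrite !take_cat sv sv' -En ltnn subnn !take0 !cats0.
Qed.

Lemma poly_delay_expanded k : poly_delay (expanded k).
Proof.
apply: (@poly_delay_run _ (solve k) 100 5) => x [n [s [v [z [-> sv sz]]]]].
have := @run_solve n (map val s) v z (size (encode s ++ bits (v ++ z)) + 100)
  (all_size_map_val s) sv.
rewrite /= -encodeE sz leqnn => /(_ isT)[X [R le]].
exists (solutions n (map val s) v), X; split=> //; first exact: uniq_solutions.
by move=> y; apply: iff_sym; apply: sols_expanded.
Qed.

Lemma Closure_reduces_to_IndSet k : 0 < k ->
  pd_reduces (EnumClosureMax (S12 k)) (EnumKMaxIndSet k).
Proof.
move=> k0; exists (fun x => reduction k k true (width x) (rows x)), (expanded k); split.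
- have [c [p H]] := polytime_reduction k k true.
  exists c, p => x [n [s ->]]; apply: H.
  by exists n; eexists; split; [exact: encodeE|exact: all_size_map_val].
- exact: poly_delay_expanded.
move=> _ [n [s ->]].
have -> : reduction k k true (width (encode s)) (rows (encode s))
  = reduction k k true n (map val s).
  rewrite encodeE; congr reduction.
    by rewrite -[enc _ _]cats0 (width_enc _ _ [::]).
  by rewrite -[enc _ _]cats0 (rows_enc _ _ [::]).
have cat (V : {set 'I_n}) : exists2 z, size z = k & val (charvec (@lshift n k @: V)) = charvec V ++ z.
  by have [z sz] := charvec_cat (@lshift n k @: V); rewrite preimset_lshiftK; exists z.
split.
- by rewrite reductionE; do 2 eexists; split; [reflexivity|exact: dimension_edges].
- move=> y /(sols_reduction_Closure _ k0)[V _ ->]; have [z sz ->] := cat V.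
  by do 4 eexists; split; [reflexivity|rewrite size_tuple|].
- move=> y z /(sols_reduction_Closure _ k0)[V mV ->] /(sols_reduction_Closure _ k0)[W mW ->] yz u.
  have [z1 s1 E1] := cat V; have [z2 s2 E2] := cat W.
  rewrite E1 E2 !sols_expanded ?size_tuple // => -[uV uW].
  apply: yz; suff -> : V = W by [].
  (* A full set is the only maximal one, so two different sets are both not full, and each then
     yields at most itself. *)
  have maxT X Y : maxset (covb k [set:: s]) X -> maxset (covb k [set:: s]) Y ->
      X = setT -> X = Y.
    move=> /maxsetP[cX _] /maxsetP[_ mY] XT; apply: mY => //.
    by rewrite XT subsetT.
  have [VT|VT] := eqVneq V setT; first exact: maxT.
  have [WT|WT] := eqVneq W setT; first by apply/esym; apply: maxT.
  have one (X : {set 'I_n}) : X != setT -> u \in map bits (solutions n (map val s) (charvec X)) ->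
      u = bits (charvec X).
    move=> XT; rewrite /solutions all_charvec (negPf XT) [filter _ _]/=.
    by case: (has _ _); rewrite ?inE // => /eqP.
  have := one _ WT uW; rewrite (one _ VT uV) => E.
  by apply/charvec_inj/val_inj/(inj_map (f := Some)) => // ? ? [].
- move=> u; rewrite sols_EnumClosureMax maximal_solutions //.
  split=> [[V mV uV]|[y [] /(sols_reduction_Closure _ k0)[V mV ->]]].
    exists (bits (charvec (@lshift n k @: V))); split.
      by apply/(sols_reduction_Closure _ k0); exists V.
    by have [z sz ->] := cat V; rewrite sols_expanded ?size_tuple.
  have [z sz ->] := cat V; rewrite sols_expanded ?size_tuple // => uV.
  by exists V.
Qed.

Theorem theorem44 (k : nat) (hk : 3 < k) :
  pd_equivalent (EnumClosureMax (S12 k)) (EnumKMaxIndSet k).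
Proof.
have k0 : 0 < k by apply: leq_trans hk.
by split; [apply: Closure_reduces_to_IndSet|apply: IndSet_reduces_to_Closure].
Qed.
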